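(* Let $n\in\mathbb{N}$. The bead degree is well defined in $\mathcal{A}^R_n(\emptyset)$. Thus there is a grading $$\mathcal{A}^R_n(\emptyset)=\bigoplus_{p\in\mathbb{N}}\mathcal{A}^R_{n,p}(\emptyset),$$ where $\mathcal{A}^R_{n,p}(\emptyset)$ is the subspace of $\mathcal{A}^R_n(\emptyset)$ generated by diagrams with bead degree $p$. Furthermore, $\mathcal{A}^R_{n,0}(\emptyset)\simeq\mathcal{A}_n(\emptyset)$, and for every $p>0$, $\mathcal{A}^R_{n,p}(\emptyset)\simeq\mathcal{A}^R_{n,1}(\emptyset)$ (isomorphisms of $\mathbb{Q}$-vector spaces).
   Context: $\mathbb{N}$ contains $0$. **Diagrams.** An $\emptyset$-diagram is an isomorphism class of finite trivalent graphs $K$ with a cyclic ordering of the three oriented edges starting at each vertex. $\mathcal{A}(\emptyset)$ is the $\mathbb{Q}$-vector space generated by $\emptyset$-diagrams modulo: - (AS): reversing the cyclic order at one vertex changes the sign; - (IHX): $D_{12}+D_{23}+D_{31}=0$, where the three diagrams are identical except near one edge $e$ with four outer half-edges $1,2,3,4$, and for $(i,j,k)$ a cyclic permutation of $(1,2,3)$ the two ends of $e$ in $D_{ij}$ have cyclic orders $(i,j,e)$ and $(e,k,4)$. The loop degree of a diagram (with or without beads) is the first Betti number of the underlying graph. $\mathcal{A}_n(\emptyset)$ is the subspace of $\mathcal{A}(\emptyset)$ generated by diagrams of loop degree $n$. **Diagrams with beads.** Let $G=\{b^n: n\in\mathbb{Z}\}$ be infinite cyclic, $R=\mathbb{Q}G=\mathbb{Q}[b,b^{-1}]$,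 and $a\mapsto\overline{a}$ the $\mathbb{Q}$-algebra involution of $R$ with $\overline{b}=b^{-1}$. A diagram with beads in $R$ is an $\emptyset$-diagram $K$ with a map $f$ from its oriented edges to $R$ such that $f(-e)=\overline{f(e)}$, where $-e$ is $e$ with reversed orientation. $\mathcal{A}^R(\emptyset)$ is the $\mathbb{Q}$-vector space generated by diagrams with beads in $R$ modulo: (AS); (IHX) applied near an edge with bead $1$; PUSH (multiplying by $b$ the beads of the three edges at a vertex, all oriented outwards from that vertex, does not change the element); multilinearity (linearity in the bead of each edge). It is graded by the loop degree, $\mathcal{A}^R(\emptyset)=\bigoplus_{n\in\mathbb{N}}\mathcal{A}^R_n(\emptyset)$. **Cohomological presentation.** By multilinearity it suffices to use beads in $G\simeq\mathbb{Z}$; then $f$ is a $1$-cocycle with values in $\mathbb{Z}$, and PUSH says that only its class in $H^1(K,\mathbb{Z})$ matters. Hence $\mathcal{A}^R(\emptyset)$ is also the $\mathbb{Q}$-vector space generated by (isomorphism classes of) pairs $(K,x)$ with $K$ an $\emptyset$-diagram and $x\in H^1(K,\mathbb{Z})$, modulo (AS) (reversing the cyclic order at a vertex while keeping $x$ changes the sign) and (IHX): if $K_{12},K_{23},K_{31}$ are three diagrams appearing in an (IHX) relation at an edge $e$ and $K_\bullet$ is the common graph obtained by collapsing $e$, with collapse maps $p_{ij}:K_{ij}\to K_\bullet$ (which induce isomorphisms on $H^1$), then for each $x\in H^1(K_\bullet,\mathbb{Z})$ one has $(K_{12},p_{12}^*x)+(K_{23},p_{23}^*x)+(K_{31},p_{31}^*x)=0$.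 **Bead degree.** $H^1(K,\mathbb{Z})$ is a free $\mathbb{Z}$-module. The bead degree of $(K,x)$ is the $p\in\mathbb{N}$ such that $x$ is $p$ times an indivisible element of $H^1(K,\mathbb{Z})$ (so $p=0$ exactly when $x=0$). *)

(* Defs.v *)
From HB Require Import structures.
From mathcomp Require Import all_boot all_order all_fingroup all_algebra.
From mathcomp Require Import generic_quotient ring_quotient finmap.
From mathcomp Require Import boolp.
From mathcomp.multinomials Require Import monalg.

Set Implicit Arguments.
Unset Strict Implicit.
Unset Printing Implicit Defensive.

Import GRing.Theory.
Local Open Scope ring_scope.
Local Open Scope quotient_scope.

Section Span.
Variables (V : lmodType rat) (S : V -> Prop).

Definition lspan : {pred V} := fun v =>
  `[< exists s : seq (rat * V),
        (forall x, x \in s -> S x.2) /\ v = \sum_(x <- s) x.1 *: x.2 >].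

Lemma lspan_submod_closed : submod_closed lspan.
Proof.
split; first by apply/asboolP; exists [::]; rewrite big_nil.
move=> a u v /asboolP[s [sS ->]] /asboolP[t [tS ->]]; apply/asboolP.
exists ([seq (a * x.1, x.2) | x <- s] ++ t); split=> [x|].
  by rewrite mem_cat => /orP[/mapP[y ys ->] /=|]; [exact: sS|exact: tS].
by rewrite big_cat big_map scaler_sumr; congr (_ + _);
   apply: eq_bigr => x _; rewrite scalerA.
Qed.

HB.instance Definition _ :=
  GRing.isSubmodClosed.Build rat V lspan lspan_submod_closed.

Record subspace : Type :=
  Subspace { subspace_val :> V; _ : subspace_val \in lspan }.
HB.instance Definition _ := [isSub for subspace_val].
HB.instance Definition _ := [Choice of subspace by <:].
HB.instance Definition _ := [SubChoice_isSubLmodule of subspace by <:].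

(* The quotient of V by the subspace generated by S. *)
Definition lquot : Type := Quotient.quot (lspan : zmodClosed V).
HB.instance Definition _ := EqQuotient.on lquot.
HB.instance Definition _ := GRing.Zmodule.on lquot.

Definition lproj (v : V) : lquot := \pi_lquot v.

Definition lquot_scale (a : rat) (x : lquot) : lquot := lproj (a *: repr x).

Lemma lprojP u v : reflect (lproj u = lproj v) (u - v \in lspan).
Proof.
rewrite (Quotient.idealrBE (lspan : zmodClosed V)); exact: eqP.
Qed.

Lemma lprojD : {morph lproj : u v / u + v}.
Proof. by move=> u v; rewrite /lproj !piE. Qed.

Lemma lprojK (x : lquot) : lproj (repr x) = x.
Proof. exact: reprK. Qed.

Lemma lprojZ_subproof a u : lproj (a *: u) = lquot_scale a (lproj u).
Proof.
by apply/lprojP; rewrite -scalerBr rpredZ //; apply/lprojP; rewrite lprojK.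
Qed.

Fact lquot_scaleA a b x : lquot_scale a (lquot_scale b x) = lquot_scale (a * b) x.
Proof. by rewrite -[x]lprojK -!lprojZ_subproof scalerA. Qed.
Fact lquot_scale1 : left_id 1 lquot_scale.
Proof. by move=> x; rewrite -[x]lprojK -lprojZ_subproof scale1r. Qed.
Fact lquot_scaleDr : right_distributive lquot_scale +%R.
Proof.
move=> a x y; rewrite -[x]lprojK -[y]lprojK -lprojD -!lprojZ_subproof.
by rewrite scalerDr lprojD.
Qed.
Fact lquot_scaleDl x : {morph lquot_scale^~ x : a b / a + b}.
Proof.
by move=> a b /=; rewrite -[x]lprojK -!lprojZ_subproof scalerDl lprojD.
Qed.

HB.instance Definition _ := GRing.Zmodule_isLmodule.Build rat lquot
  lquot_scaleA lquot_scale1 lquot_scaleDr lquot_scaleDl.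

Lemma lproj_is_linear : linear lproj.
Proof. by move=> a u v; rewrite lprojD lprojZ_subproof. Qed.
HB.instance Definition _ :=
  GRing.isLinear.Build rat V lquot *:%R lproj lproj_is_linear.

End Span.

Definition isomorphic (U V : lmodType rat) : Prop :=
  exists f : {linear U -> V}, bijective f.

(* Internal direct sum: every vector of U is in a unique way the sum of a
   finitely supported family of vectors of the W p. *)
Definition direct_sum (V : lmodType rat) (U : {pred V}) (W : nat -> {pred V}) :
    Prop :=
  (forall p, {subset W p <= U}) /\
  {in U, forall v, exists! w : {fsfun nat -> V with 0},
     (forall p, w p \in W p) /\ v = \sum_(p <- finsupp w) w p}.

(* The ring Q[b, b^-1]: << a *g k >> stands for a b^k. *)
Definition laurent : Type := {malg rat[int]}.
HB.instance Definition _ := GRing.Lmodule.copy laurent {malg rat[int]}.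

Section Laurent.
Implicit Types f g h : laurent.

Definition bpow (k : int) : laurent := << 1 *g k >>.

Definition lmul f g : laurent :=
  \sum_(i <- msupp f) \sum_(j <- msupp g) << f@_i * g@_j *g i + j >>.

Definition conj f : laurent := \sum_(i <- msupp f) << f@_i *g - i >>.

Lemma lmulEw (d1 d2 : {fset int}) f g :
  (msupp f `<=` d1)%fset -> (msupp g `<=` d2)%fset ->
  lmul f g = \sum_(i <- d1) \sum_(j <- d2) << f@_i * g@_j *g i + j >>.
Proof.
move=> le1 le2; rewrite /lmul (big_fset_incl _ le1) /=.
  apply: eq_bigr => i _; apply: big_fset_incl => // j _ /mcoeff_outdom ->.
  by rewrite mulr0 monalgU0.
move=> i _ /mcoeff_outdom fi.
by rewrite big1 // => j _; rewrite fi mul0r monalgU0.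
Qed.

Lemma lmulUU a b i j :
  lmul << a *g i >> << b *g j >> = << a * b *g i + j >>.
Proof. by rewrite (lmulEw msuppU_le msuppU_le) !big_seq_fset1 !mcoeffUU. Qed.

Lemma lmulC : commutative lmul.
Proof.
move=> f g; rewrite /lmul exchange_big; apply: eq_bigr => i _.
by apply: eq_bigr => j _; rewrite mulrC addrC.
Qed.

Lemma lmulDl : left_distributive lmul +%R.
Proof.
move=> f1 f2 g; have gg := fsubset_refl (msupp g).
rewrite (lmulEw (fsubsetUl (msupp f1) (msupp f2)) gg).
rewrite (lmulEw (fsubsetUr (msupp f1) (msupp f2)) gg).
rewrite (lmulEw (msuppD_le f1 f2) gg).
rewrite -big_split; apply: eq_bigr => i _; rewrite -big_split.
by apply: eq_bigr => j _; rewrite /= mcoeffD mulrDl monalgUD.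
Qed.

Lemma lmulDr : right_distributive lmul +%R.
Proof. by move=> f g h; rewrite lmulC lmulDl !(lmulC f). Qed.

Lemma lmul0l : left_zero 0 lmul.
Proof. by move=> f; rewrite /lmul msupp0 big_seq_fset0. Qed.

Lemma lmul_suml (I : Type) (r : seq I) (F : I -> laurent) g :
  lmul (\sum_(i <- r) F i) g = \sum_(i <- r) lmul (F i) g.
Proof.
exact: (big_morph (lmul^~ g) (fun _ _ => lmulDl _ _ _) (lmul0l _)).
Qed.

Lemma lmul_sumr (I : Type) (r : seq I) (F : I -> laurent) g :
  lmul g (\sum_(i <- r) F i) = \sum_(i <- r) lmul g (F i).
Proof.
by rewrite lmulC lmul_suml; apply: eq_bigr => i _; rewrite lmulC.
Qed.

Lemma laurentE f : f = \sum_(i <- msupp f) (<< f@_i *g i >> : laurent).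
Proof. exact: monalgE. Qed.

Lemma lmulA : associative lmul.
Proof.
move=> f g h; rewrite (laurentE f) (laurentE g) (laurentE h).
rewrite !lmul_suml; apply: eq_bigr => i _.
rewrite [LHS]lmul_sumr (lmul_sumr _ _ << f@_i *g i >>) lmul_suml.
apply: eq_bigr => j _; rewrite !lmul_sumr; apply: eq_bigr => k _.
by rewrite !lmulUU mulrA addrA.
Qed.

Lemma lmul1l : left_id (bpow 0) lmul.
Proof.
move=> f; rewrite {1}(laurentE f) lmul_sumr [RHS]laurentE.
by apply: eq_bigr => i _; rewrite lmulUU mul1r add0r.
Qed.

Lemma bpow0_neq0 : bpow 0 != 0 :> laurent.
Proof. by apply/eqP => /malgP/(_ 0)/eqP; rewrite mcoeffU eqxx mcoeff0. Qed.

HB.instance Definition _ := GRing.Zmodule_isComNzRing.Build laurent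
  lmulA lmulC lmul1l lmulDl bpow0_neq0.

Lemma lscaleAl (a : rat) f g : a *: (f * g) = (a *: f) * g.
Proof.
have scaleU c k : a *: (<< c *g k >> : laurent) = << a * c *g k >>.
  by apply/malgP => l; rewrite mcoeffZ !mcoeffU mulrnAr.
rewrite -[RHS]/(lmul (a *: f) g) (lmulEw (msuppZ_le a f) (fsubset_refl _)).
rewrite -[f * g]/(lmul f g) /lmul scaler_sumr; apply: eq_bigr => i _.
by rewrite scaler_sumr; apply: eq_bigr => j _; rewrite scaleU mcoeffZ mulrA.
Qed.

HB.instance Definition _ := GRing.Lmodule_isLalgebra.Build rat laurent lscaleAl.
HB.instance Definition _ := GRing.Lalgebra_isComAlgebra.Build rat laurent.

Lemma conj_bpow k : conj (bpow k) = bpow (- k).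
Proof.
rewrite /conj (big_fset_incl _ (msuppU_le (k := k) (x := 1))) /=.
  by rewrite big_seq_fset1 mcoeffUU.
by move=> i _ /mcoeff_outdom ->; rewrite monalgU0.
Qed.

End Laurent.

(* A finite trivalent graph with cyclic orders at its vertices is encoded by its
   set 'I_m of oriented edges (six for each pair of vertices), the involution
   opp reversing the orientation, and the permutation rot sending an oriented
   edge to the next one in the cyclic order at its starting vertex.  The vertices
   are the orbits of rot, which all have three elements.  Loops, multiple edges,
   disconnected graphs and the empty graph (m = 0) are allowed. *)
Definition diagram_axiom (m : nat) (K : {perm 'I_m} * {perm 'I_m}) : bool :=
  [forall h, [&& K.1 h != h, K.1 (K.1 h) == h,
                 K.2 h != h & K.2 (K.2 (K.2 h)) == h]].

Record diagram (m : nat) : Type :=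
  Diagram { diagram_val : {perm 'I_m} * {perm 'I_m};
            _ : diagram_axiom diagram_val }.
HB.instance Definition _ m := [isSub for @diagram_val m].
HB.instance Definition _ m := [Choice of diagram m by <:].

Section Diagram.
Variable m : nat.
Implicit Types (K : diagram m) (e h x : 'I_m).

Definition opp K : {perm 'I_m} := (diagram_val K).1.
Definition rot K : {perm 'I_m} := (diagram_val K).2.

(* The oriented edges with the same starting vertex as h. *)
Definition star K h : {set 'I_m} := porbit (rot K) h.

Definition diagram_iso K K' (s : {perm 'I_m}) : Prop :=
  forall h, s (opp K h) = opp K' (s h) /\ s (rot K h) = rot K' (s h).

Definition reversed_at K K' h : Prop :=
  opp K' = opp K /\
  forall k, rot K' k = if k \in star K h then ((rot K)^-1)%g k else rot K k.

(* The ends of e have cyclic orders (x1, x2, e) and (e, x3, x4). *)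
Definition ends K e x1 x2 x3 x4 : Prop :=
  [/\ rot K x1 = x2, rot K x2 = e & rot K e = x1] /\
  [/\ rot K (opp K e) = x3, rot K x3 = x4 & rot K x4 = opp K e].

Definition ihx_triple K12 K23 K31 e : Prop :=
  opp K23 = opp K12 /\ opp K31 = opp K12 /\
  exists x1 x2 x3 x4,
    let local := [:: e; opp K12 e; x1; x2; x3; x4] in
    [/\ uniq local,
        ends K12 e x1 x2 x3 x4, ends K23 e x2 x3 x1 x4, ends K31 e x3 x1 x2 x4
      & forall h, h \notin local ->
          rot K23 h = rot K12 h /\ rot K31 h = rot K12 h].

(* A row vector z is killed by this matrix iff z (opp h) = - z h for all h, that
   is, z is a 1-chain of K, and the values of z on each star add up to 0, that is,
   z is a cycle. *)
Definition boundary K : 'M[rat]_(m, m + m) :=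
  row_mx (\matrix_(i, j) ((i == j)%:R + (opp K i == j)%:R))
         (\matrix_(i, j) (i \in star K j)%:R).

(* The first Betti number: the dimension of H_1(K, Q). *)
Definition loop_degree K : nat := \rank (kermx (boundary K)).

(* All 1-cochains of a graph are cocycles. *)
Definition cocycle_pred K : {pred {ffun 'I_m -> int}} :=
  fun c => [forall h, c (opp K h) == - c h].

Lemma cocycle_pred_zmod_closed K : zmod_closed (cocycle_pred K).
Proof.
split=> [|c d /forallP cP /forallP dP]; apply/forallP => h.
  by rewrite !ffunE oppr0.
by rewrite !ffunE (eqP (cP h)) (eqP (dP h)) opprB opprK addrC.
Qed.
HB.instance Definition _ K :=
  GRing.isZmodClosed.Build _ (cocycle_pred K) (cocycle_pred_zmod_closed K).

Record cocycle K : Type :=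
  Cocycle { cocycle_val : {ffun 'I_m -> int}; _ : cocycle_val \in cocycle_pred K }.
HB.instance Definition _ K := [isSub for @cocycle_val K].
HB.instance Definition _ K := [Choice of cocycle K by <:].
HB.instance Definition _ K := [SubChoice_isSubZmodule of cocycle K by <:].

(* The 0-cochain g is a function of the vertices, that is, it is constant on the
   stars; opp K h starts where h ends. *)
Definition coboundary K : {pred cocycle K} := fun c =>
  `[< exists g : 'I_m -> int, (forall h, g (rot K h) = g h) /\
        forall h, cocycle_val c h = g (opp K h) - g h >].
#[local] Arguments coboundary K _ : clear implicits.

Lemma coboundary_zmod_closed K : zmod_closed (coboundary K).
Proof.
split=> [|c d /asboolP[g [gP cg]] /asboolP[g' [gP' dg]]]; apply/asboolP.
  by exists (fun=> 0); split=> // h; rewrite ffunE subrr.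
exists (fun h => g h - g' h); split=> h; first by rewrite gP gP'.
by rewrite !ffunE cg dg !opprD !opprK addrACA.
Qed.
HB.instance Definition _ K :=
  GRing.isZmodClosed.Build _ (coboundary K) (coboundary_zmod_closed K).

Definition H1 K : Type := Quotient.quot (coboundary K : zmodClosed _).
HB.instance Definition _ K := EqQuotient.on (H1 K).
HB.instance Definition _ K := GRing.Zmodule.on (H1 K).

Definition H1class K (c : cocycle K) : H1 K := \pi_(H1 K) c.

Lemma cocycle_opp K (c : cocycle K) h :
  cocycle_val c (opp K h) = - cocycle_val c h.
Proof. by case: c => c /= /forallP/(_ h)/eqP. Qed.

End Diagram.

Definition indivisible (V : zmodType) (y : V) : Prop :=
  forall (k : nat) (z : V), y = z *+ k -> k = 1%N.

(* The case p = 0 is separate since H^1 of the empty graph is 0, which has no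
   indivisible element. *)
Definition has_bead_degree (V : zmodType) (x : V) (p : nat) : Prop :=
  if p is 0 then x = 0 else exists2 y : V, indivisible y & x = y *+ p.

Definition beaded_axiom (m : nat) (X : diagram m * {ffun 'I_m -> laurent}) : bool :=
  [forall h, X.2 (opp X.1 h) == conj (X.2 h)].

Record beaded (m : nat) : Type :=
  Beaded { beaded_val : diagram m * {ffun 'I_m -> laurent};
           _ : beaded_axiom beaded_val }.
HB.instance Definition _ m := [isSub for @beaded_val m].
HB.instance Definition _ m := [Choice of beaded m by <:].

Definition graph (m : nat) (X : beaded m) : diagram m := (beaded_val X).1.
Definition beads (m : nat) (X : beaded m) : {ffun 'I_m -> laurent} :=
  (beaded_val X).2.

Fact cocycle_beads_subproof (m : nat) (K : diagram m) (c : cocycle K) :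
  beaded_axiom (K, [ffun h => bpow (cocycle_val c h)]).
Proof. by apply/forallP => h; rewrite !ffunE cocycle_opp conj_bpow. Qed.

Definition cocycle_beaded (m : nat) (K : diagram m) (c : cocycle K) : beaded m :=
  Beaded (cocycle_beads_subproof c).

(* Isomorphic diagrams are identified through relA_iso, and beaded ones through relAR_iso. *)
Definition freeA : Type := {malg rat[{m : nat & diagram m}]}.
HB.instance Definition _ := GRing.Lmodule.copy freeA
  {malg rat[{m : nat & diagram m}]}.

Definition dgen (m : nat) (K : diagram m) : freeA :=
  << Tagged (fun m => diagram m) K >>.

Inductive relA : freeA -> Prop :=
| relA_iso m (K K' : diagram m) s :
    diagram_iso K K' s -> relA (dgen K - dgen K')
| relA_AS m (K K' : diagram m) h :
    reversed_at K K' h -> relA (dgen K + dgen K')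
| relA_IHX m (K12 K23 K31 : diagram m) e :
    ihx_triple K12 K23 K31 e -> relA (dgen K12 + dgen K23 + dgen K31).

Definition spaceA : lmodType rat := lquot relA.

Inductive genA (n : nat) : spaceA -> Prop :=
| GenA m (K : diagram m) : loop_degree K = n -> genA n (lproj relA (dgen K)).

Definition A (n : nat) : lmodType rat := subspace (genA n).

Definition freeAR : Type := {malg rat[{m : nat & beaded m}]}.
HB.instance Definition _ := GRing.Lmodule.copy freeAR
  {malg rat[{m : nat & beaded m}]}.

Definition bgen (m : nat) (X : beaded m) : freeAR :=
  << Tagged (fun m => beaded m) X >>.

(* In PUSH, if h is an edge starting and ending at the vertex, its bead is
   multiplied both by b and by b^-1. *)
Inductive relAR : freeAR -> Prop :=
| relAR_iso m (X Y : beaded m) s :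
    diagram_iso (graph X) (graph Y) s -> (forall h, beads Y (s h) = beads X h) ->
    relAR (bgen X - bgen Y)
| relAR_AS m (X Y : beaded m) h :
    reversed_at (graph X) (graph Y) h -> beads Y = beads X ->
    relAR (bgen X + bgen Y)
| relAR_IHX m (X12 X23 X31 : beaded m) e :
    ihx_triple (graph X12) (graph X23) (graph X31) e ->
    beads X23 = beads X12 -> beads X31 = beads X12 -> beads X12 e = 1 ->
    relAR (bgen X12 + bgen X23 + bgen X31)
| relAR_PUSH m (X Y : beaded m) v :
    graph Y = graph X ->
    (forall h, beads Y h =
       bpow ((h \in star (graph X) v)%:Z - (opp (graph X) h \in star (graph X) v)%:Z)
       * beads X h) ->
    relAR (bgen X - bgen Y)
| relAR_lin m (X Y Z : beaded m) e (a : rat) :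
    graph Y = graph X -> graph Z = graph X ->
    (forall h, h != e -> h != opp (graph X) e ->
       beads Y h = beads X h /\ beads Z h = beads X h) ->
    beads X e = a *: beads Y e + beads Z e ->
    relAR (bgen X - (a *: bgen Y + bgen Z)).

Definition spaceAR : lmodType rat := lquot relAR.

Inductive genAR (n : nat) : spaceAR -> Prop :=
| GenAR m (X : beaded m) : loop_degree (graph X) = n ->
    genAR n (lproj relAR (bgen X)).

Inductive genARp (n p : nat) : spaceAR -> Prop :=
| GenARp m (K : diagram m) (c : cocycle K) :
    loop_degree K = n -> has_bead_degree (H1class c) p ->
    genARp n p (lproj relAR (bgen (cocycle_beaded c))).

Definition AR (n p : nat) : lmodType rat := subspace (genARp n p).

(* Main.v *)
Require Import Defs.
From HB Require Import structures.
From mathcomp Require Import all_boot all_fingroup all_algebra.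
From mathcomp Require Import generic_quotient finmap.
From mathcomp Require Import boolp classical_sets fsbigop.
From mathcomp.multinomials Require Import monalg.
From mathcomp Require Import ring zify.

(* Expanding beads by multilinearity into powers of b shows that linear maps out
   of A^R are the same as functions of pairs (K, c), c an integral cocycle, that
   respect isomorphism, AS, IHX (when c vanishes on e) and PUSH.  Such functions
   are built from the relation "the class of c is k times that of d" in H^1(K, Z),
   which all these moves preserve.  It determines the bead degree, as the p whose
   divisors are exactly the k dividing the class of c, so that truncating
   (K, c) |-> [K, c] to degree p gives the projections onto the summands.  As H^1
   is torsion free, multiplication by p is inverted by division by p on the
   classes of degree p, and forgetting c is inverted in degree 0 by K |-> [K, 0]. *)

Set Implicit Arguments.
Unset Strict Implicit.
Unset Printing Implicit Defensive.

Import GRing.Theory Num.Theory Defs.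
Local Open Scope ring_scope.
Local Open Scope quotient_scope.

(** The three graphs of an IHX relation have the same oriented edges and the same reversal; only the
    grouping of edges into vertices differs. One integer function can thus be a cocycle for all
    three, and comparing its classes means comparing potentials. The delicate case is division: a
    cocycle [c] vanishing on [e] may have a quotient [d] that does not vanish on [e], to which IHX
    does not apply, so [d] must first be corrected by a coboundary. Defined through an indivisible
    quotient, the bead degree is visibly neither unique nor always present. Uniqueness comes from
    Bezout in a torsion-free group. Existence needs a bound on the divisors of a nonzero class; it
    is obtained from potentials modulo k, without a basis of H^1. *)

(** * Linear maps on spans, free modules and quotients *)

Lemma lspan_gen (V : lmodType rat) (S : V -> Prop) v : S v -> v \in lspan S.
Proof.
move=> Sv; apply/asboolP; exists [:: (1, v)]; split=> [x|].
  by rewrite inE => /eqP ->.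
by rewrite big_seq1 scale1r.
Qed.

Lemma lspan_ind (V : lmodType rat) (S P : V -> Prop) :
  P 0 -> (forall a u v, P u -> P v -> P (a *: u + v)) ->
  (forall v, S v -> P v) -> {in lspan S, forall v, P v}.
Proof.
move=> P0 PD PS v /asboolP[s [sS ->]].
elim: s sS => [|x s IHs] sS; first by rewrite big_nil.
rewrite big_cons; apply: PD; first by apply: PS; apply: sS; rewrite mem_head.
by apply: IHs => y ys; apply: sS; rewrite in_cons ys orbT.
Qed.

Lemma lspan_sub (V : lmodType rat) (S : V -> Prop) (U : submodClosed V) :
  (forall v, S v -> v \in U) -> {subset lspan S <= U}.
Proof.
move=> SU; apply: (lspan_ind (P := fun v => v \in U)) => [|a u w uU wU|//].
  exact: rpred0.
by rewrite rpredD ?rpredZ.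
Qed.

Lemma lspan_map (V W : lmodType rat) (S : V -> Prop) (U : submodClosed W)
    (f : {linear V -> W}) :
  (forall v, S v -> f v \in U) -> {in lspan S, forall v, f v \in U}.
Proof.
move=> SU; apply: (lspan_ind (P := fun v => f v \in U)) => [|a u w uU wU|//].
  by rewrite linear0 rpred0.
by rewrite linearP rpredD ?rpredZ.
Qed.

Lemma eq_on_lspan (V W : lmodType rat) (S : V -> Prop) (f g : {linear V -> W}) :
  (forall v, S v -> f v = g v) -> {in lspan S, f =1 g}.
Proof.
move=> fg; apply: (lspan_ind (P := fun v => f v = g v)) => [|a u v fu fv|//].
  by rewrite !linear0.
by rewrite !linearP fu fv.
Qed.

Lemma isomorphic_subspace (V W : lmodType rat) (S : V -> Prop) (T : W -> Prop)
    (f : {linear V -> W}) (g : {linear W -> V}) :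
  (forall v, S v -> f v \in lspan T) -> (forall w, T w -> g w \in lspan S) ->
  (forall v, S v -> g (f v) = v) -> (forall w, T w -> f (g w) = w) ->
  isomorphic (subspace S) (subspace T).
Proof.
move=> fS gT fK gK.
have fS' (v : subspace S) : f (val v) \in lspan T by exact: (lspan_map fS) (valP v).
have gT' (w : subspace T) : g (val w) \in lspan S by exact: (lspan_map gT) (valP w).
pose F v : subspace T := Subspace (fS' v); pose G w : subspace S := Subspace (gT' w).
have F_lin : linear F.
  by move=> a u v; apply: val_inj; rewrite /= !linearP.
pose F' : {linear subspace S -> subspace T} :=
  HB.pack F (GRing.isLinear.Build rat _ _ _ F F_lin).
exists F'; exists G => [v|w]; apply: val_inj => /=.
  exact: (eq_on_lspan (f := g \o f) (g := idfun) fK (valP v)).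
exact: (eq_on_lspan (f := f \o g) (g := idfun) gK (valP w)).
Qed.

Lemma malg_lift (I : choiceType) (V : lmodType rat) (f : I -> V) :
  exists F : {linear {malg rat[I]} -> V}, forall i, F << i >> = f i.
Proof.
pose F (g : {malg rat[I]}) : V := \sum_(i <- msupp g) g@_i *: f i.
(* The sum may run over any finite set containing the support, so linearity can be checked on one
   common set. *)
have FE (d : {fset I}) g : (msupp g `<=` d)%fset -> F g = \sum_(i <- d) g@_i *: f i.
  move=> le_g; apply: big_fset_incl => // i _ /mcoeff_outdom ->.
  by rewrite scale0r.
have F_lin : linear F.
  move=> a g h; pose d := (msupp g `|` msupp h `|` msupp (a *: g + h))%fset.
  rewrite !(FE d) ?fsubsetUr //; first last.
  - by rewrite /d -fsetUA fsubsetUl.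
  - by rewrite /d fsetUAC fsubsetUr.
  rewrite scaler_sumr -big_split; apply: eq_bigr => i _ /=.
  by rewrite mcoeffD mcoeffZ scalerDl scalerA.
pose F' : {linear {malg rat[I]} -> V} :=
  HB.pack F (GRing.isLinear.Build rat _ _ _ F F_lin).
exists F' => i; rewrite /= (FE [fset i]%fset) ?msuppU_le // big_seq_fset1.
by rewrite mcoeffUU scale1r.
Qed.

Lemma lquot_lift (V W : lmodType rat) (S : V -> Prop) (f : {linear V -> W}) :
  (forall v, S v -> f v = 0) ->
  exists F : {linear lquot S -> W}, forall v, F (lproj S v) = f v.
Proof.
move=> f0; pose F (x : lquot S) : W := f (repr x).
have FE v : F (lproj S v) = f v.
  apply/eqP; rewrite -subr_eq0 -linearB; apply/eqP.
  apply: (eq_on_lspan (f := f) (g := \0) f0); apply/lprojP; exact: lprojK.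
have F_lin : linear F.
  move=> a x y; rewrite -[x]lprojK -[y]lprojK -linearP !FE.
  exact: linearP.
pose F' : {linear lquot S -> W} := HB.pack F (GRing.isLinear.Build rat _ _ _ F F_lin).
by exists F'.
Qed.

Lemma lproj_rel (V : lmodType rat) (S : V -> Prop) v : S v -> lproj S v = 0.
Proof.
by move=> Sv; rewrite -(linear0 (lproj S)); apply/lprojP; rewrite subr0 lspan_gen.
Qed.

Section LinearEval.
Variables (V W : lmodType rat) (f : {linear V -> W}).
Variables (u v w : V) (u' v' w' : W).
Hypotheses (fu : f u = u') (fv : f v = v') (fw : f w = w').

Lemma linear_eval_sub : u' = v' -> f (u - v) = 0.
Proof. by move=> e; rewrite linearB fu fv e subrr. Qed.

Lemma linear_eval_add : u' + v' = 0 -> f (u + v) = 0.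
Proof. by rewrite linearD fu fv. Qed.

Lemma linear_eval_add3 : u' + v' + w' = 0 -> f (u + v + w) = 0.
Proof. by rewrite !linearD fu fv fw. Qed.

Lemma linear_eval_comb (a : rat) : u' = a *: v' + w' -> f (u - (a *: v + w)) = 0.
Proof. by move=> e; rewrite linearB linearP fu fv fw e subrr. Qed.

End LinearEval.

Lemma spaceA_lift (V : lmodType rat) (phi : {m : nat & diagram m} -> V) :
  (forall m (K K' : diagram m) s, diagram_iso K K' s ->
     phi (Tagged _ K) = phi (Tagged _ K')) ->
  (forall m (K K' : diagram m) h, reversed_at K K' h ->
     phi (Tagged _ K) + phi (Tagged _ K') = 0) ->
  (forall m (K12 K23 K31 : diagram m) e, ihx_triple K12 K23 K31 e ->
     phi (Tagged _ K12) + phi (Tagged _ K23) + phi (Tagged _ K31) = 0) ->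
  exists F : {linear spaceA -> V},
    forall m (K : diagram m), F (lproj relA (dgen K)) = phi (Tagged _ K).
Proof.
move=> iso AS IHX; have [f fE] : exists f : {linear freeA -> V},
    forall m (K : diagram m), f (dgen K) = phi (Tagged _ K).
  by have [f fP] := malg_lift phi; exists f => m K; rewrite -fP.
have [|F FE] := lquot_lift (S := relA) (f := f).
  move=> _ [m K K' s /iso e|m K K' h /AS e|m K12 K23 K31 e /IHX E].
  - exact: linear_eval_sub (fE _ _) (fE _ _) e.
  - exact: linear_eval_add (fE _ _) (fE _ _) e.
  - exact: linear_eval_add3 (fE _ _) (fE _ _) (fE _ _) E.
by exists F => m K; rewrite FE.
Qed.

(** * Coefficients of beads and the multilinear expansion *)

Lemma mcoeff_conj (f : laurent) k : (conj f)@_k = f@_(- k).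
Proof.
rewrite [in RHS](laurentE f) /conj !raddf_sum /=; apply: eq_bigr => i _.
by rewrite !mcoeffU eqr_oppLR.
Qed.

Lemma mcoeff_bpowM (f : laurent) j k : (bpow j * f)@_(j + k) = f@_k.
Proof.
rewrite [in RHS](laurentE f) [in LHS](laurentE f).
rewrite [bpow j * _](lmul_sumr _ _ (bpow j)) !raddf_sum /=.
by apply: eq_bigr => i _; rewrite lmulUU mul1r !mcoeffU (inj_eq (addrI j)).
Qed.

Lemma mcoeff_laurent1 k : (1 : laurent)@_k = (k == 0)%:R.
Proof. by rewrite -[1]/(bpow 0) mcoeffU eq_sym. Qed.

Section Diagrams.
Variable m : nat.
Implicit Types (K : diagram m) (X : beaded m) (h e : 'I_m).
Implicit Types (c d u : {ffun 'I_m -> int}).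

Lemma oppK K : involutive (opp K).
Proof. by move=> h; have /forallP/(_ h)/and4P[_ /eqP] := valP K. Qed.

Lemma opp_neq K h : opp K h != h.
Proof. by have /forallP/(_ h)/and4P[] := valP K. Qed.

Lemma opp_gt K h : (opp K h < h)%N = ~~ (h < opp K h)%N.
Proof. by rewrite -leqNgt ltn_neqAle opp_neq. Qed.

(** A predicate negated by [opp] chooses one orientation of every edge. Where two such choices
    disagree, reversal matches them and preserves [F]. *)
Lemma prod_transversal (R : comPzRingType) K (P Q : pred 'I_m) (F : 'I_m -> R) :
  (forall h, P (opp K h) = ~~ P h) -> (forall h, Q (opp K h) = ~~ Q h) ->
  (forall h, F (opp K h) = F h) -> \prod_(h | P h) F h = \prod_(h | Q h) F h.
Proof.
move=> PN QN FN; rewrite (bigID Q) [RHS](bigID P) /=; congr (_ * _).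
  by apply: eq_bigl => h; rewrite andbC.
rewrite (reindex_inj (inv_inj (@oppK K))); apply: eq_big => [h|h _].
  by rewrite PN QN negbK andbC.
exact: FN.
Qed.

Lemma cocycleP K c :
  reflect (forall h, c (opp K h) = - c h) (c \in cocycle_pred K).
Proof. exact: 'forall_eqP. Qed.

Lemma mcoeff_beads_opp X h k : (beads X (opp (graph X) h))@_k = (beads X h)@_(- k).
Proof.
by rewrite -mcoeff_conj; have /forallP/(_ h)/eqP <- := valP X.
Qed.

(* The coefficient of [b ^ c] in the expansion of [X] by multilinearity. *)
Definition weight X c : rat :=
  if c \in cocycle_pred (graph X)
  then \prod_(h : 'I_m | (h < opp (graph X) h)%N) (beads X h)@_(c h) else 0.

(** The orientation chosen in [weight] depends on the numbering of the edges. Isomorphisms renumber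
    them, and linearity at [e] needs [e] among the chosen ones, so the choice has to be free. *)
Lemma weightE X c (P : pred 'I_m) : c \in cocycle_pred (graph X) ->
  (forall h, P (opp (graph X) h) = ~~ P h) ->
  weight X c = \prod_(h | P h) (beads X h)@_(c h).
Proof.
move=> cX PN; rewrite /weight cX; apply: (@prod_transversal _ (graph X)) => // h.
  by rewrite oppK opp_gt.
by rewrite mcoeff_beads_opp (cocycleP _ _ cX) opprK.
Qed.

Lemma weight_supp X c : weight X c != 0 -> forall h, c h \in msupp (beads X h).
Proof.
rewrite /weight; case: ifP => [/cocycleP cX|_]; last by rewrite eqxx.
move=> /prodf_neq0 w h; rewrite -mcoeff_neq0.
have [lt_h|] := boolP (h < opp (graph X) h)%N; first exact: w.
rewrite -opp_gt => lt_h; have := w (opp (graph X) h).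
by rewrite oppK mcoeff_beads_opp cX opprK; apply.
Qed.

Lemma finite_weight_supp X :
  exists A : {fset {ffun 'I_m -> int}}, forall c, c \notin A -> weight X c = 0.
Proof.
(* [r] lists the exponents occurring in all the beads. A function of nonzero weight takes its values
   in [r], which leaves finitely many. *)
pose r : seq int := flatten [seq enum_fset (msupp (beads X h)) | h <- enum 'I_m].
pose val_r (i : {ffun 'I_m -> 'I_(size r)}) := [ffun h => nth 0 r (i h)].
exists [fset val_r i | i : {ffun 'I_m -> 'I_(size r)}]%fset => c.
apply: contraNeq => /weight_supp cX.
have ltr h : (index (c h) r < size r)%N.
  rewrite index_mem; apply/flattenP; exists (enum_fset (msupp (beads X h))) => //.
  by apply/mapP; exists h => //; rewrite mem_enum.
apply/imfsetP; exists [ffun h => Ordinal (ltr h)] => //.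
by apply/ffunP => h; rewrite !ffunE /= nth_index // -index_mem.
Qed.

End Diagrams.

(** * Weights under the relations of A^R *)

Section Weights.
Variable m : nat.
Implicit Types (K : diagram m) (X Y Z : beaded m) (h e : 'I_m).
Implicit Types (c d u : {ffun 'I_m -> int}).

Lemma cocycle_pred_opp K K' c :
  opp K' = opp K -> (c \in cocycle_pred K') = (c \in cocycle_pred K).
Proof. by move=> e; rewrite !unfold_in e. Qed.

Lemma weight_eq X Y : opp (graph Y) = opp (graph X) -> beads Y = beads X ->
  weight Y =1 weight X.
Proof. by move=> eo eb c; rewrite /weight (cocycle_pred_opp _ eo) eo eb. Qed.

(** The bead 1 is b^0. Hence the IHX relation of A^R involves only cocycles that vanish on [e]. *)
Lemma weight_bead1 X c e : beads X e = 1 -> weight X c != 0 -> c e = 0.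
Proof.
move=> e1 /weight_supp/(_ e); rewrite -mcoeff_neq0 e1 mcoeff_laurent1.
by rewrite pnatr_eq0 eqb0 negbK => /eqP.
Qed.

Lemma weight_iso X Y s c c' :
  diagram_iso (graph X) (graph Y) s -> (forall h, beads Y (s h) = beads X h) ->
  (forall h, c' (s h) = c h) -> weight Y c' = weight X c.
Proof.
move=> sP sb sc; have so h : s (opp (graph X) h) = opp (graph Y) (s h).
  by have [] := sP h.
have cXY : (c' \in cocycle_pred (graph Y)) = (c \in cocycle_pred (graph X)).
  apply/cocycleP/cocycleP => cP h; first by rewrite -!sc so cP.
  by have := cP (s^-1 h)%g; rewrite -!sc so permKV.
have [cX|/negPf cX] := boolP (c \in cocycle_pred (graph X)); last first.
  by rewrite /weight cXY cX.
rewrite {1}/weight cXY cX (reindex_inj (@perm_inj _ s)) /=.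
rewrite (@weightE _ X c (fun h => (s h < opp (graph Y) (s h))%N)) //.
  by apply: eq_bigr => h _; rewrite sb sc.
by move=> h; rewrite so oppK opp_gt.
Qed.

Lemma weight_push X Y u c :
  graph Y = graph X -> u \in cocycle_pred (graph X) ->
  (forall h, beads Y h = bpow (u h) * beads X h) -> weight Y (u + c) = weight X c.
Proof.
move=> eg uX eb; rewrite /weight eg rpredDl //.
by case: ifP => // _; apply: eq_bigr => h _; rewrite eb ffunE mcoeff_bpowM.
Qed.

Lemma weightD1 X c e : c \in cocycle_pred (graph X) ->
  weight X c = (beads X e)@_(c e) *
    \prod_(h : 'I_m | (h < opp (graph X) h)%N && (h != e) && (h != opp (graph X) e))
      (beads X h)@_(c h).
Proof.
move=> cX; pose P h := (h == e) ||
  (h < opp (graph X) h)%N && (h != e) && (h != opp (graph X) e).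
have oE h h' : (opp (graph X) h == h') = (h == opp (graph X) h').
  by rewrite (inv_eq (@oppK m (graph X))).
rewrite (@weightE _ X c P) //.
  rewrite (bigD1 e) ?/P ?eqxx //=; congr (_ * _); apply: eq_bigl => h.
  by case: eqP => [->|]; rewrite ?andbF ?andbT.
move=> h; rewrite /P oppK !oE oppK opp_gt.
have [->|/negPf hoe] := eqVneq h (opp (graph X) e).
  by rewrite (negPf (opp_neq _ _)) !andbF.
by have [->|/negPf he] := eqVneq h e; rewrite ?andbF ?andbT //= !andbT.
Qed.

Lemma weight_lin X Y Z e (a : rat) c :
  graph Y = graph X -> graph Z = graph X ->
  (forall h, h != e -> h != opp (graph X) e ->
     beads Y h = beads X h /\ beads Z h = beads X h) ->
  beads X e = a *: beads Y e + beads Z e ->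
  weight X c = a * weight Y c + weight Z c.
Proof.
move=> eY eZ eb ebe.
have [cX|/negPf cX] := boolP (c \in cocycle_pred (graph X)); last first.
  by rewrite /weight eY eZ cX mulr0 addr0.
rewrite !(weightD1 e) ?eY ?eZ // ebe mcoeffD mcoeffZ mulrDl mulrA.
by congr (_ * _ + _ * _); apply: eq_bigr => h /andP[/andP[_ he] hoe];
   have [eYh eZh] := eb h he hoe; rewrite ?eYh ?eZh.
Qed.

Lemma weight_cocycle K (x : cocycle K) c :
  weight (cocycle_beaded x) c = (c == cocycle_val x)%:R.
Proof.
have [->|ne] := eqVneq c (cocycle_val x).
  rewrite /weight (valP x) big1 // => h _.
  by rewrite /beads /= ffunE mcoeffU eqxx.
apply: contra_neq_eq ne => /weight_supp w; apply/ffunP => h.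
have := w h; rewrite /beads /= ffunE -mcoeff_neq0 mcoeffU.
by rewrite pnatr_eq0 eqb0 negbK => /eqP.
Qed.

End Weights.

(** The exponents that PUSH at [v] adds to the beads: the coboundary of minus the indicator function
    of the vertex. It is 0 on a loop at [v]. *)
Definition vertex_cochain m (K : diagram m) v : {ffun 'I_m -> int} :=
  [ffun h => (h \in star K v)%:Z - (opp K h \in star K v)%:Z].

Lemma vertex_cochain_cocycle m (K : diagram m) v :
  vertex_cochain K v \in cocycle_pred K.
Proof. by apply/cocycleP => h; rewrite !ffunE oppK opprB. Qed.

(* A cocycle that vanishes on e is one pulled back from the graph with e collapsed. *)
Definition bead_invariant (V : lmodType rat)
    (phi : forall m, diagram m -> {ffun 'I_m -> int} -> V) : Prop :=
  [/\ forall m (K K' : diagram m) s (c c' : {ffun 'I_m -> int}), diagram_iso K K' s ->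
        c \in cocycle_pred K -> (forall h, c' (s h) = c h) ->
        phi m K c = phi m K' c',
      forall m (K K' : diagram m) h c, reversed_at K K' h ->
        c \in cocycle_pred K -> phi m K c + phi m K' c = 0,
      forall m (K12 K23 K31 : diagram m) e c, ihx_triple K12 K23 K31 e ->
        c \in cocycle_pred K12 -> c e = 0 ->
        phi m K12 c + phi m K23 c + phi m K31 c = 0
    & forall m (K : diagram m) v c, c \in cocycle_pred K ->
        phi m K (vertex_cochain K v + c) = phi m K c].

(** * Linear maps out of A^R from invariant functions *)

Section Expand.
Variables (V : lmodType rat).
Variable phi : forall m, diagram m -> {ffun 'I_m -> int} -> V.

(** Only finitely many functions have nonzero weight. Summing over all of them nevertheless lets
    PUSH and isomorphisms act as bijections of the whole index set. *)
Definition expand m (X : beaded m) : V :=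
  \sum_(c \in [set: {ffun 'I_m -> int}]) weight X c *: phi (graph X) c.

Lemma expandE m (X : beaded m) (A : {fset {ffun 'I_m -> int}}) :
  (forall c, c \notin A -> weight X c = 0) ->
  expand X = \sum_(c <- A) weight X c *: phi (graph X) c.
Proof. by move=> A0; apply: fsbigTE => c /A0 ->; rewrite scale0r. Qed.

Lemma expand_cocycle m (K : diagram m) (x : cocycle K) :
  expand (cocycle_beaded x) = phi K (cocycle_val x).
Proof.
rewrite (@expandE _ _ [fset cocycle_val x]%fset) => [|c].
  by rewrite big_seq_fset1 weight_cocycle eqxx scale1r.
by rewrite inE weight_cocycle => /negPf ->.
Qed.

Hypothesis phiP : bead_invariant phi.

Lemma expand_iso m (X Y : beaded m) s :
  diagram_iso (graph X) (graph Y) s -> (forall h, beads Y (s h) = beads X h) ->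
  expand X = expand Y.
Proof.
move=> sP sb; have [iso _ _ _] := phiP.
pose r (t : {perm 'I_m}) (c : {ffun 'I_m -> int}) := [ffun h => c (t h)].
rewrite /expand (reindex_fsbigT (r s)); last first.
  exists (r s^-1)%g => c; apply/ffunP => h; rewrite !ffunE ?permK ?permKV //.
apply: eq_fsbigr => c _; have rE h : c (s h) = r s c h by rewrite ffunE.
rewrite (weight_iso sP sb rE).
have [cX|/negPf cX] := boolP (r s c \in cocycle_pred (graph X)).
  by rewrite (iso _ _ _ _ _ _ sP cX rE).
by rewrite /weight cX !scale0r.
Qed.

Lemma expand_AS m (X Y : beaded m) h :
  reversed_at (graph X) (graph Y) h -> beads Y = beads X ->
  expand X + expand Y = 0.
Proof.
move=> rP eb; have [_ AS _ _] := phiP; have [A A0] := finite_weight_supp X.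
have wE := weight_eq rP.1 eb.
rewrite !(@expandE _ _ A) // => [|c cA]; last by rewrite wE A0.
rewrite -big_split big1 //= => c _; rewrite wE -scalerDr.
have [cX|/negPf cX] := boolP (c \in cocycle_pred (graph X)).
  by rewrite (AS _ _ _ _ _ rP cX) scaler0.
by rewrite /weight cX scale0r.
Qed.

Lemma expand_IHX m (X12 X23 X31 : beaded m) e :
  ihx_triple (graph X12) (graph X23) (graph X31) e ->
  beads X23 = beads X12 -> beads X31 = beads X12 -> beads X12 e = 1 ->
  expand X12 + expand X23 + expand X31 = 0.
Proof.
move=> rP eb eb' e1; have [_ _ IHX _] := phiP.
have [A A0] := finite_weight_supp X12; have [eo [eo' _]] := rP.
have wE := weight_eq eo eb; have wE' := weight_eq eo' eb'.
rewrite !(@expandE _ _ A) // => [|c cA|c cA]; rewrite ?wE ?wE' ?A0 //.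
rewrite -!big_split big1 //= => c _; rewrite wE wE' -!scalerDr.
have [cX|/negPf cX] := boolP (c \in cocycle_pred (graph X12)); last first.
  by rewrite /weight cX scale0r.
have [-> | w0] := eqVneq (weight X12 c) 0; first by rewrite scale0r.
by rewrite (IHX _ _ _ _ _ _ rP cX) ?scaler0 ?(weight_bead1 e1 w0).
Qed.

Lemma expand_PUSH m (X Y : beaded m) v :
  graph Y = graph X ->
  (forall h, beads Y h = bpow (vertex_cochain (graph X) v h) * beads X h) ->
  expand X = expand Y.
Proof.
move=> eg eb; have [_ _ _ PUSH] := phiP; set u := vertex_cochain _ _ in eb.
have uX : u \in cocycle_pred (graph X) by exact: vertex_cochain_cocycle.
rewrite /expand [RHS](reindex_fsbigT (+%R u)); last first.
  by exists (+%R (- u)) => c; rewrite ?addKr ?addNKr.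
apply: eq_fsbigr => c _; rewrite (weight_push _ eg uX eb) eg.
have [cX|/negPf cX] := boolP (c \in cocycle_pred (graph X)).
  by rewrite PUSH.
by rewrite /weight cX !scale0r.
Qed.

Lemma expand_lin m (X Y Z : beaded m) e (a : rat) :
  graph Y = graph X -> graph Z = graph X ->
  (forall h, h != e -> h != opp (graph X) e ->
     beads Y h = beads X h /\ beads Z h = beads X h) ->
  beads X e = a *: beads Y e + beads Z e ->
  expand X = a *: expand Y + expand Z.
Proof.
move=> eY eZ eb ebe.
have [AX AX0] := finite_weight_supp X; have [AY AY0] := finite_weight_supp Y.
have [AZ AZ0] := finite_weight_supp Z.
rewrite !(@expandE _ _ (AX `|` AY `|` AZ)%fset) => [|c|c|c]; first last.
- by rewrite !inE !negb_or => /andP[/andP[/AX0]].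
- by rewrite !inE !negb_or => /andP[/andP[_ /AY0]].
- by rewrite !inE !negb_or => /andP[_ /AZ0].
rewrite scaler_sumr -big_split; apply: eq_bigr => c _ /=.
by rewrite (weight_lin _ eY eZ eb ebe) eY eZ scalerDl scalerA.
Qed.

(* The universal property of the cohomological presentation. *)
Lemma spaceAR_lift : exists F : {linear spaceAR -> V},
  forall m (K : diagram m) (x : cocycle K),
    F (lproj relAR (bgen (cocycle_beaded x))) = phi K (cocycle_val x).
Proof.
have [f fE] : exists f : {linear freeAR -> V},
    forall m (X : beaded m), f (bgen X) = expand X.
  have [f fP] := malg_lift (fun X : {m : nat & beaded m} => expand (tagged X)).
  by exists f => m X; rewrite -[expand X]/(expand (tagged (Tagged _ X))) -fP.
have [|F FE] := lquot_lift (S := relAR) (f := f).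
  move=> _ [m X Y s h1 h2|m X Y h h1 h2|m X Y Z e h1 h2 h3 h4|
            m X Y v h1 h2|m X Y Z e a h1 h2 h3 h4].
  - exact: linear_eval_sub (fE _ _) (fE _ _) (expand_iso h1 h2).
  - exact: linear_eval_add (fE _ _) (fE _ _) (expand_AS h1 h2).
  - exact: linear_eval_add3 (fE _ _) (fE _ _) (fE _ _) (expand_IHX h1 h2 h3 h4).
  - apply: linear_eval_sub (fE _ _) (fE _ _) (@expand_PUSH _ _ _ v h1 _) => h.
    by rewrite h2 ffunE.
  - apply: (@linear_eval_comb _ _ f (bgen X) (bgen Y) (bgen Z) _ _ _
              (fE _ _) (fE _ _) (fE _ _) a).
    exact: expand_lin h1 h2 h3 h4.
by exists F => m K x; rewrite FE fE expand_cocycle.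
Qed.

End Expand.

(** * Spanning of A^R by graphs with integral cocycles *)

Section LprojRel.
Variables (V : lmodType rat) (S : V -> Prop).
Implicit Types u v w : V.

Lemma lproj_sub u v : S (u - v) -> lproj S u = lproj S v.
Proof. by move=> Suv; apply/lprojP; exact: lspan_gen. Qed.

Lemma lproj_add u v : S (u + v) -> lproj S u + lproj S v = 0.
Proof. by move=> /lproj_rel; rewrite linearD. Qed.

Lemma lproj_add3 u v w :
  S (u + v + w) -> lproj S u + lproj S v + lproj S w = 0.
Proof. by move=> /lproj_rel; rewrite !linearD. Qed.

Lemma lproj_comb u v w (a : rat) :
  S (u - (a *: v + w)) -> lproj S u = a *: lproj S v + lproj S w.
Proof. by move=> /lproj_sub ->; rewrite linearP. Qed.

End LprojRel.

Lemma conjK : involutive conj.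
Proof. by move=> f; apply/malgP => k; rewrite !mcoeff_conj opprK. Qed.

Lemma bpow_inj : injective bpow.
Proof.
move=> j k /malgP/(_ j); rewrite !mcoeffU eqxx => /eqP.
by case: (eqVneq k j) => [->|] // _; rewrite eq_sym oner_eq0.
Qed.

Lemma laurent_sum_bpow (f : laurent) : f = \sum_(i <- msupp f) f@_i *: bpow i.
Proof.
apply/malgP => k; rewrite {1}(laurentE f) !raddf_sum; apply: eq_bigr => i _ /=.
by rewrite mcoeffZ !mcoeffU mulrnAr mulr1.
Qed.

Section Spanning.
Variable m : nat.
Implicit Types (K : diagram m) (X : beaded m) (h e : 'I_m) (f : laurent).

Lemma beadsN X h : beads X (opp (graph X) h) = conj (beads X h).
Proof. by have /forallP/(_ h)/eqP := valP X. Qed.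

Lemma beaded_eq X Y : graph X = graph Y -> beads X =1 beads Y -> X = Y.
Proof.
move=> eg eb; apply/val_inj; case: X Y eg eb => [[K f] /= ?] [[L g] /= ?].
by rewrite /graph /beads /= => -> /ffunP ->.
Qed.

Fact set_bead_subproof : {F : beaded m -> 'I_m -> laurent -> beaded m |
  forall X e f, graph (F X e f) = graph X &
  forall X e f h, beads (F X e f) h =
    if h == e then f else if h == opp (graph X) e then conj f else beads X h}.
Proof.
have F_ax X e f : beaded_axiom (graph X, [ffun h => if h == e then f else
    if h == opp (graph X) e then conj f else beads X h]).
  apply/forallP => h; rewrite !ffunE /= (inj_eq perm_inj); apply/eqP.
  have [->|hoe] := eqVneq h (opp (graph X) e).
    by rewrite oppK (negPf (opp_neq _ _)) eqxx conjK.
  rewrite -(inj_eq (@perm_inj _ (opp (graph X)))) oppK (negPf hoe).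
  by case: (h == e); rewrite ?beadsN.
by exists (fun X e f => Beaded (F_ax X e f)) => // X e f h; rewrite /beads ffunE.
Qed.

Definition set_bead : beaded m -> 'I_m -> laurent -> beaded m :=
  s2val set_bead_subproof.

Lemma graph_set_bead X e f : graph (set_bead X e f) = graph X.
Proof. exact: (s2valP set_bead_subproof X e f). Qed.

Lemma set_beadE X e f h : beads (set_bead X e f) h =
  if h == e then f else if h == opp (graph X) e then conj f else beads X h.
Proof. exact: (s2valP' set_bead_subproof X e f). Qed.

Lemma set_bead_id X e : set_bead X e (beads X e) = X.
Proof.
apply: beaded_eq => [|h]; first exact: graph_set_bead.
rewrite set_beadE; case: eqP => [->|_] //.
by case: eqP => [->|_] //; rewrite beadsN.
Qed.

Lemma lproj_set_bead X e (a : rat) f f' g : g = a *: f + f' ->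
  lproj relAR (bgen (set_bead X e g)) =
  a *: lproj relAR (bgen (set_bead X e f)) + lproj relAR (bgen (set_bead X e f')).
Proof.
have eg f1 f2 : graph (set_bead X e f1) = graph (set_bead X e f2).
  by rewrite !graph_set_bead.
have outside h : h != e -> h != opp (graph (set_bead X e g)) e ->
    beads (set_bead X e f) h = beads (set_bead X e g) h /\
    beads (set_bead X e f') h = beads (set_bead X e g) h.
  rewrite graph_set_bead => he hoe.
  by rewrite !set_beadE (negPf he) (negPf hoe).
move=> gE; have at_e : beads (set_bead X e g) e =
    a *: beads (set_bead X e f) e + beads (set_bead X e f') e.
  rewrite !set_beadE eqxx; exact: gE.
exact: lproj_comb (relAR_lin (eg _ _) (eg _ _) outside at_e).
Qed.

Definition cocycle_gen K : spaceAR -> Prop := fun v =>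
  exists x : cocycle K, v = lproj relAR (bgen (cocycle_beaded x)).

Let bad X : {set 'I_m} := [set h | ~~ `[< exists k, beads X h = bpow k >]].

Lemma bad_set_bead X e k : e \in bad X -> (#|bad (set_bead X e (bpow k))| < #|bad X|)%N.
Proof.
move=> eX; apply/proper_card/properP; split; last first.
  exists e => //; rewrite inE negbK; apply/asboolP; exists k.
  by rewrite set_beadE eqxx.
apply/fintype.subsetP => h; rewrite !inE; apply: contra => /asboolP[j jE].
apply/asboolP; rewrite set_beadE.
case: eqP => _; first by exists k.
by case: eqP => _; [exists (- k); rewrite conj_bpow | exists j].
Qed.

(** Induction on the number of oriented edges whose bead is not a power of b: expanding one such
    bead gives diagrams with fewer of them. *)
Lemma bgen_spanned X : lproj relAR (bgen X) \in lspan (cocycle_gen (graph X)).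
Proof.
have [n] := ubnP #|bad X|; elim: n => // n IHn in X *; rewrite ltnS => leXn.
have [bad0|[e eX]] := set_0Vmem (bad X); last first.
  suff sum_bpow (a : int -> rat) r f : f = \sum_(i <- r) a i *: bpow i ->
      lproj relAR (bgen (set_bead X e f)) \in lspan (cocycle_gen (graph X)).
    by rewrite -[X in bgen X](set_bead_id X e); apply: sum_bpow (laurent_sum_bpow _).
  elim: r f => [|i r IHr] f.
    rewrite big_nil => f0.
    (* Writing 0 as (-1) 0 + 0, multilinearity equates a diagram x having a zero bead with -x +
       x. *)
    have := @lproj_set_bead X e (-1) f f f; rewrite f0 scaler0 addr0 => /(_ erefl).
    by rewrite scaleN1r addNr => ->; exact: rpred0.
  rewrite big_cons => /lproj_set_bead ->.
  rewrite rpredD ?IHr // rpredZ //.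
  rewrite -(graph_set_bead X e (bpow i)).
  by apply: IHn; apply: leq_trans leXn; exact: bad_set_bead.
have bX h : exists k, beads X h = bpow k.
  by apply/asboolP; have := finset.in_set0 h; rewrite -bad0 finset.inE => /negbFE.
have [c cE] := choice bX.
have cX : [ffun h => c h] \in cocycle_pred (graph X).
  apply/cocycleP => h; rewrite !ffunE; apply: bpow_inj.
  by rewrite -cE beadsN cE conj_bpow.
apply: lspan_gen; exists (Cocycle cX); congr (lproj _ (bgen _)).
by apply: beaded_eq => // h; rewrite {2}/beads /= !ffunE.
Qed.

(* Junk value 0 when c is not a cocycle. *)
Definition cls K (c : {ffun 'I_m -> int}) : spaceAR :=
  if insub c is Some x then lproj relAR (bgen (cocycle_beaded (x : cocycle K))) else 0.

Lemma cls_val K (x : cocycle K) :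
  cls K (cocycle_val x) = lproj relAR (bgen (cocycle_beaded x)).
Proof. by rewrite /cls valK. Qed.

Lemma clsE K c (cK : c \in cocycle_pred K) :
  cls K c = lproj relAR (bgen (cocycle_beaded (Cocycle cK))).
Proof. by rewrite -cls_val. Qed.

End Spanning.

Lemma cocycle_iso m (K K' : diagram m) s (c c' : {ffun 'I_m -> int}) :
  diagram_iso K K' s -> (forall h, c' (s h) = c h) ->
  c \in cocycle_pred K -> c' \in cocycle_pred K'.
Proof.
move=> sP sc /cocycleP cK; apply/cocycleP => h.
rewrite -[h](permKV s); have [<- _] := sP (s^-1 h)%g.
by rewrite !sc cK.
Qed.

(** The universal invariant function: truncation, multiplication and division will all be applied to
    it. *)
Lemma cls_invariant : bead_invariant cls.
Proof.
split=> [m K K' s c c' sP cK sc|m K K' h c rP cK|m K12 K23 K31 e c rP cK c0|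
         m K v c cK].
- have cK' := cocycle_iso sP sc cK.
  rewrite !clsE; apply: lproj_sub (relAR_iso (s := s) _ _) => // h.
  by rewrite /beads /= !ffunE sc.
- have cK' : c \in cocycle_pred K' by rewrite (cocycle_pred_opp _ rP.1).
  by rewrite !clsE; apply: lproj_add (relAR_AS (h := h) _ _).
- have [e1 [e2 _]] := rP.
  have cK' : c \in cocycle_pred K23 by rewrite (cocycle_pred_opp _ e1).
  have cK'' : c \in cocycle_pred K31 by rewrite (cocycle_pred_opp _ e2).
  rewrite !clsE; apply: lproj_add3 (relAR_IHX (e := e) _ _ _ _) => //.
  by rewrite /beads /= ffunE c0.
have uK : vertex_cochain K v + c \in cocycle_pred K.
  by rewrite rpredD // vertex_cochain_cocycle.
rewrite !clsE; apply: esym (lproj_sub (relAR_PUSH (v := v) _ _)) => // h.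
by rewrite /beads /= !ffunE -[RHS]/(lmul _ _) lmulUU mul1r.
Qed.

(** * Coboundaries and divisibility in H^1 *)

Section Cohomology.
Variable m : nat.
Implicit Types (K : diagram m) (h v : 'I_m) (c d u : {ffun 'I_m -> int}).

Lemma rotK3 K h : rot K (rot K (rot K h)) = h.
Proof. by have /forallP/(_ h)/and4P[_ _ _ /eqP] := valP K. Qed.

Lemma star_rot K h : star K (rot K h) = star K h.
Proof. exact: (porbit_perm (rot K) 1 h). Qed.

Lemma mem_star_id K h : h \in star K h.
Proof. exact: porbit_id. Qed.

Lemma mem_star_rot K v h : (rot K h \in star K v) = (h \in star K v).
Proof. by rewrite /star -!eq_porbit_mem [porbit _ (rot K h)](star_rot K h). Qed.

Lemma mem_star K v h :
  (h \in star K v) = [|| h == v, h == rot K v | h == rot K (rot K v)].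
Proof.
apply/idP/or3P => [/porbitP[i ->]|].
  elim: i => [|i IHi]; first by rewrite expg0 perm1; exact: Or31.
  rewrite expgSr permM; case: IHi => /eqP ->; [exact: Or32|exact: Or33|].
  by rewrite rotK3; exact: Or31.
by case=> /eqP->; rewrite ?mem_star_rot mem_star_id.
Qed.

Lemma rot_inv_star (T : Type) K (g : 'I_m -> T) v h :
  (forall h, g (rot K h) = g h) -> h \in star K v -> g h = g v.
Proof.
move=> gP /porbitP[i ->]; elim: i => [|i IHi]; first by rewrite expg0 perm1.
by rewrite expgSr permM gP.
Qed.

Lemma star_rep K : exists2 rep : 'I_m -> 'I_m,
  forall h, rep h \in star K h & forall v h, h \in star K v -> rep h = rep v.
Proof.
exists (fun h => odflt h [pick x in star K h]) => [h|v h].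
  by case: pickP => //= /(_ h); rewrite mem_star_id.
rewrite /star -eq_porbit_mem => /eqP ->.
by case: pickP => //= /(_ v); rewrite porbit_id.
Qed.

(** The condition of [coboundary] on bare functions, so that the same [u] can be tested on several
    graphs. *)
Definition is_cob K u : Prop := exists g : 'I_m -> int,
  (forall h, g (rot K h) = g h) /\ forall h, u h = g (opp K h) - g h.

Lemma ffunMzE u k h : (u *~ k) h = u h *~ k.
Proof. by case: k => k; rewrite /intmul ?ffunE ffunMnE. Qed.

Lemma coboundaryP K (x : cocycle K) :
  (x \in @coboundary m K) <-> is_cob K (cocycle_val x).
Proof. by split=> [/asboolP|?]; last apply/asboolP. Qed.

Lemma cob0 K : is_cob K 0.
Proof. by exists (fun=> 0); split=> // h; rewrite ffunE subrr. Qed.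

Lemma cobB K u w : is_cob K u -> is_cob K w -> is_cob K (u - w).
Proof.
move=> [g [gP ug]] [g' [gP' wg]]; exists (fun h => g h - g' h).
by split=> h; rewrite ?gP ?gP' // !ffunE ug wg !opprD !opprK addrACA.
Qed.

Lemma cobN K u : is_cob K u -> is_cob K (- u).
Proof. by rewrite -sub0r; apply: cobB; exact: cob0. Qed.

Lemma cobD K u w : is_cob K u -> is_cob K w -> is_cob K (u + w).
Proof. by move=> cu cw; rewrite -[w]opprK; apply: cobB => //; exact: cobN. Qed.

Lemma cobMn K u k : is_cob K u -> is_cob K (u *+ k).
Proof.
move=> cu; elim: k => [|k IHk]; first by rewrite mulr0n; exact: cob0.
by rewrite mulrS; exact: cobD.
Qed.

Lemma cobMz K u k : is_cob K u -> is_cob K (u *~ k).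
Proof.
by move=> cu; case: k => k; rewrite ?NegzE ?mulrNz; [|apply: cobN]; exact: cobMn.
Qed.

(* H^1 is torsion free: divide the potential by k and round down. *)
Lemma cob_torsion_free K u k : (0 < k)%N -> is_cob K (u *+ k) -> is_cob K u.
Proof.
move=> k0 [g [gP ug]]; exists (fun h => (g h %/ k%:Z)%Z).
split=> h; first by rewrite gP.
have -> : g (opp K h) = u h * k%:Z + g h.
  by have := ug h; rewrite ffunMnE -mulr_natr natz => ->; rewrite subrK.
by rewrite divzMDl ?addrK //; case: k k0 {ug}.
Qed.

(** A potential is a combination of indicators of vertices, where [rep v == v] keeps one edge per
    star. The coefficients are [- g v] because [vertex_cochain] is minus the coboundary of an
    indicator. Thus PUSH at single vertices generates all coboundaries. *)
Lemma cob_vertex_sum K u : is_cob K u -> exists (n : 'I_m -> int) (P : pred 'I_m),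
  u = \sum_(v | P v) vertex_cochain K v *~ n v.
Proof.
move=> [g [gP ug]]; have [rep repP rep_star] := star_rep K.
have gE h : \sum_(v | rep v == v) (h \in star K v)%:Z *~ g v = g h.
  rewrite (bigD1 (rep h)) ?(rep_star _ _ (repP h)) //=.
  rewrite /star porbit_sym repP /= big1 ?addr0.
    by rewrite intz; apply: rot_inv_star gP (repP h).
  move=> v /andP[/eqP vv].
  case: (boolP (h \in _)) => [/rep_star hv|_]; last by rewrite mul0rz.
  by rewrite hv vv eqxx.
exists (fun v => - g v), (fun v => rep v == v); apply/ffunP => h.
rewrite ug -!gE sum_ffunE -sumrB; apply: eq_bigr => v _.
by rewrite ffunMzE ffunE mulrNz mulrzBl opprB.
Qed.

(** The cocycles by which translation preserves [phi] form a group, and PUSH puts every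
    [vertex_cochain] in it. *)
Lemma invariant_cob (V : lmodType rat) phi K u c :
  @bead_invariant V phi -> is_cob K u -> c \in cocycle_pred K ->
  phi m K (u + c) = phi m K c.
Proof.
move=> [_ _ _ PUSH] /cob_vertex_sum[n [P ->]] cK.
pose shift u := u \in cocycle_pred K /\
  forall c, c \in cocycle_pred K -> phi m K (u + c) = phi m K c.
have shift0 : shift 0 by split=> [|d _]; rewrite ?rpred0 ?add0r.
have shiftD u1 u2 : shift u1 -> shift u2 -> shift (u1 + u2).
  move=> [u1K u1P] [u2K u2P]; split=> [|d dK]; first exact: rpredD.
  by rewrite -addrA u1P ?u2P ?rpredD.
have shiftN u1 : shift u1 -> shift (- u1).
  move=> [u1K u1P]; split=> [|d dK]; first by rewrite rpredN.
  by rewrite -u1P ?addNKr ?rpredD ?rpredN // addrA subrr add0r.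
have shiftM u1 k : shift u1 -> shift (u1 *~ k).
  move=> u1P; have nat_case (j : nat) : shift (u1 *+ j).
    by elim: j => [|j IHj]; rewrite ?mulrS //; exact: shiftD.
  by case: k => k; rewrite ?NegzE ?mulrNz; [|apply: shiftN]; exact: nat_case.
have [_] : shift (\sum_(v | P v) vertex_cochain K v *~ n v); last exact.
apply: big_ind => // v _; apply: shiftM.
by split=> [|d dK]; [exact: vertex_cochain_cocycle | exact: PUSH].
Qed.

(* The class of c is k times the class of d in H^1. *)
Definition quotient_of K c k d : Prop :=
  d \in cocycle_pred K /\ is_cob K (c - d *+ k).

(** Two quotients of [c] by [k] differ by a torsion class, hence by a coboundary. This makes
    division well defined. *)
Lemma quotient_of_uniq (V : lmodType rat) phi K c k d d' :
  @bead_invariant V phi -> (0 < k)%N ->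
  quotient_of K c k d -> quotient_of K c k d' -> phi m K d = phi m K d'.
Proof.
move=> phiP k0 [dK dq] [d'K d'q]; rewrite -(subrK d' d); apply: invariant_cob => //.
apply: (cob_torsion_free k0); have := cobB d'q dq.
by rewrite opprB addrC addrA subrK mulrnBl.
Qed.

End Cohomology.

(** * Divisibility under isomorphism, AS, PUSH and IHX *)

Section Moves.
Variable m : nat.
Implicit Types (K : diagram m) (h e v : 'I_m) (c d u : {ffun 'I_m -> int}).

Lemma diagram_isoV K K' s : diagram_iso K K' s -> diagram_iso K' K s^-1%g.
Proof.
move=> sP h; have [so sr] := sP (s^-1 h)%g; rewrite permKV in so sr.
by rewrite -so -sr !permK.
Qed.

Lemma cob_iso K K' s u u' :
  diagram_iso K K' s -> (forall h, u' (s h) = u h) -> is_cob K u -> is_cob K' u'.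
Proof.
move=> sP su [g [gP ug]]; exists (fun h => g (s^-1 h)%g).
have sP' := diagram_isoV sP; split=> h; first by rewrite (sP' h).2 gP.
by rewrite (sP' h).1 -{1}[h](permKV s) su ug.
Qed.

Lemma quotient_of_iso K K' s c c' k d : diagram_iso K K' s ->
  (forall h, c' (s h) = c h) -> quotient_of K c k d ->
  quotient_of K' c' k [ffun h => d (s^-1 h)%g].
Proof.
move=> sP sc [dK dq]; have sd h : [ffun h => d (s^-1 h)%g] (s h) = d h.
  by rewrite ffunE permK.
split; first exact: cocycle_iso sP sd dK.
by apply: cob_iso sP _ dq => h; rewrite !ffunE sc !ffunMnE sd.
Qed.

Lemma cob_reversed K K' h u : reversed_at K K' h -> is_cob K u <-> is_cob K' u.
Proof.
move=> [eo er]; have inv_rot g : (forall k, g (rot K' k) = g k :> int) <->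
    (forall k, g (rot K k) = g k).
  split=> gP k; last first.
    by rewrite er; case: ifP => // _; rewrite -[in RHS](permKV (rot K) k) gP.
  have [kh|/negPf kh] := boolP (k \in star K h); last by rewrite -(gP k) er kh.
  by rewrite -(gP (rot K k)) er mem_star_rot kh permK.
by split=> -[g [/inv_rot gP ug]]; exists g; split=> // k; rewrite ug eo.
Qed.

Lemma quotient_of_reversed K K' h c k d : reversed_at K K' h ->
  quotient_of K c k d <-> quotient_of K' c k d.
Proof.
move=> rP; rewrite /quotient_of (cocycle_pred_opp d rP.1).
by split=> -[dK]; split=> //; apply/(cob_reversed _ rP).
Qed.

Lemma cob_vertex K v : is_cob K (vertex_cochain K v).
Proof.
exists (fun h => - (h \in star K v)%:Z); split=> h; first by rewrite mem_star_rot.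
by rewrite ffunE opprK addrC.
Qed.

Lemma quotient_of_cob K u c k d : is_cob K u ->
  quotient_of K (u + c) k d <-> quotient_of K c k d.
Proof.
move=> cu; split=> -[dK dq]; split=> //.
  by rewrite -[c](addKr u) -addrA; apply: cobD dq; exact: cobN.
by rewrite -addrA; apply: cobD.
Qed.

Lemma ihx_triple_rot K12 K23 K31 e :
  ihx_triple K12 K23 K31 e -> ihx_triple K23 K31 K12 e.
Proof.
move=> [e1 [e2 [x1 [x2 [x3 [x4 [U E12 E23 E31 out]]]]]]].
split; first by rewrite e1 e2.
have pl : perm_eq [:: e; opp K23 e; x2; x3; x1; x4] [:: e; opp K12 e; x1; x2; x3; x4].
  by rewrite e1; apply/seq.permP => P /=; lia.
split=> //; exists x2, x3, x1, x4; split=> //; first by rewrite (perm_uniq pl).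
by move=> h; rewrite (perm_mem pl) => /out[-> ->].
Qed.

(** As [u] vanishes on [e], a potential has equal values at the two ends of [e], hence on all six
    local edges. Regrouping these edges keeps it constant at the vertices. *)
Lemma ihx_cob K12 K23 K31 e u : ihx_triple K12 K23 K31 e -> u e = 0 ->
  is_cob K12 u -> is_cob K23 u.
Proof.
move=> [e1 [e2 [x1 [x2 [x3 [x4 [U E12 E23 E31 out]]]]]]] u0 [g [gP ug]].
exists g; split=> [h|h]; last by rewrite e1.
have ge : g (opp K12 e) = g e by apply/eqP; rewrite -subr_eq0 -ug u0.
have [[r1 r2 r3] [r4 r5 r6]] := E12; have [[s1 s2 s3] [s4 s5 s6]] := E23.
rewrite e1 in s4 s6.
have := gP x1; have := gP x2; have := gP x3; have := gP x4.
rewrite r1 r2 r5 r6 => g4 g3 g2 g1.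
have [|hout] := boolP (h \in [:: e; opp K12 e; x1; x2; x3; x4]); last first.
  by rewrite (out h hout).1.
by rewrite !inE => /or4P[|||/or3P[]] /eqP->;
  rewrite ?s1 ?s2 ?s3 ?s4 ?s5 ?s6; congruence.
Qed.

Lemma quotient_of_ihx K12 K23 K31 e c k d : ihx_triple K12 K23 K31 e ->
  c \in cocycle_pred K12 -> c e = 0 -> quotient_of K12 c k d ->
  exists2 d' : {ffun 'I_m -> int}, d' e = 0 &
    [/\ quotient_of K12 c k d', quotient_of K23 c k d' & quotient_of K31 c k d'].
Proof.
move=> triple cK c0 [dK dq].
have [e1 [e2 [x1 [x2 [x3 [x4 [U [_ [r4 r5 _]] _ _ _]]]]]]] := triple.
(* Correct d by a multiple of the coboundary of the end of e, so that it vanishes on e. *)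
pose d' := d + vertex_cochain K12 (opp K12 e) *~ d e.
have d'K : d' \in cocycle_pred K12.
  by rewrite rpredD // rpredMz // vertex_cochain_cocycle.
(* The local edges are distinct, so [e] is not a loop and the added [vertex_cochain] is -1 on
   [e]. *)
have eoe : e \notin star K12 (opp K12 e).
  rewrite mem_star r4 r5; move: U; rewrite /= !inE !negb_or.
  by case/andP => /and5P[-> _ _ -> /= ->].
have d'e : d' e = 0.
  rewrite !ffunE ffunMzE ffunE (negPf eoe) mem_star_id sub0r mulNrz.
  by rewrite intz subrr.
have d'q : is_cob K12 (c - d' *+ k).
  rewrite mulrnDl opprD addrA; apply: cobB dq _.
  exact/cobMn/cobMz/cob_vertex.
have d'k : (c - d' *+ k) e = 0 by rewrite !ffunE ffunMnE c0 d'e mul0rn subr0.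
have c23 := ihx_cob triple d'k d'q.
have c31 := ihx_cob (ihx_triple_rot triple) d'k c23.
exists d' => //; split; split=> //.
  by rewrite (cocycle_pred_opp _ e1).
by rewrite (cocycle_pred_opp _ e2).
Qed.

End Moves.

(** * Bead degree in a torsion-free group *)

Section BeadDegree.
Variable V : zmodType.
Hypothesis torsion_free : forall (y : V) k, (0 < k)%N -> y *+ k = 0 -> y = 0.
Implicit Types x y z : V.

Lemma indivisible_neq0 y : indivisible y -> y <> 0.
Proof. by move=> yI y0; have := yI 2 0; rewrite mul0rn => /(_ y0). Qed.

(** Let x be both y p, with y indivisible, and z k. Torsion freeness cancels gcd(p, k), leaving y a
    = z b with a and b coprime. Bezout makes y a multiple of b, so b = 1 and k divides p. *)
Lemma has_bead_degreeP x p : has_bead_degree x p <->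
  (exists y, x = y *+ p) /\ forall k z, x = z *+ k -> (k %| p)%N.
Proof.
split=> [|[[y xy] xmax]].
  case: p => [->|p [y yI xy]]; first by split=> [|k z _]; [exists 0|].
  split=> [|k z xz]; first by exists y.
  have k0 : (0 < k)%N.
    rewrite lt0n; apply/eqP => k0; apply: (indivisible_neq0 yI).
    by apply: (@torsion_free _ p.+1) => //; rewrite -xy xz k0 mulr0n.
  have g0 : (0 < gcdn p.+1 k)%N by rewrite gcdn_gt0.
  have cop : coprime (p.+1 %/ gcdn p.+1 k) (k %/ gcdn p.+1 k).
    by rewrite /coprime -(eqn_pmul2r g0) muln_gcdl !divnK ?dvdn_gcdl ?dvdn_gcdr // mul1n.
  set a := (_ %/ _)%N in cop; set b := (_ %/ _)%N in cop.
  have yazb : y *+ a = z *+ b.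
    apply/eqP; rewrite -subr_eq0; apply/eqP/(torsion_free g0).
    rewrite mulrnBl -!mulrnA !divnK ?dvdn_gcdl ?dvdn_gcdr //.
    by rewrite -xy -xz subrr.
  have a0 : (0 < a)%N by rewrite divn_gt0 // dvdn_leq ?dvdn_gcdl.
  have [[u v] /= uv1] := coprimeP _ a0 cop.
  have b1 : b = 1%N.
    (* From u a - v b = 1 and y a = z b follows y = (z u - y v) b. *)
    apply: (yI b (z *+ u - y *+ v)); rewrite mulrnBl -!mulrnA -[y in LHS]mulr1n -uv1.
    rewrite mulrnBr; last by lia.
    by rewrite ![(u * _)%N]mulnC !(mulrnA _ _ u) yazb.
  by rewrite -(divnK (dvdn_gcdr p.+1 k)) -/b b1 mul1n dvdn_gcdl.
case: p xy xmax => [|p] xy xmax; first by rewrite /= xy mulr0n.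
exists y => // k z yz; have := xmax (k * p.+1)%N z.
rewrite mulrnA -yz => /(_ xy) /(dvdn_leq (ltn0Sn p)).
rewrite -[X in (_ <= X)%N]mul1n leq_pmul2r //.
have k0 : k <> 0%N.
  move=> k0; have := xmax 0%N 0; rewrite xy yz k0 !mulr0n mul0rn.
  by move=> /(_ erefl).
by case: k {yz} k0 => [|[|k]].
Qed.

(** If [y] is [k] times an element, then [k * p] divides [x]. So a divisor that is merely largest in
    size already has an indivisible quotient. *)
Lemma has_bead_degree_max x p y : x <> 0 -> x = y *+ p ->
  (forall k z, x = z *+ k -> (k <= p)%N) -> has_bead_degree x p.
Proof.
case: p => [|p] x0 xy pmax; first by rewrite xy mulr0n in x0.
exists y => // k z yz; have := pmax (k * p.+1)%N z.
rewrite mulrnA -yz => /(_ xy); rewrite -[X in (_ <= X)%N]mul1n leq_pmul2r //.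
case: k yz => [|[|k]] // yz _.
by case: x0; rewrite xy yz mulr0n mul0rn.
Qed.

End BeadDegree.

(** * Existence and uniqueness of the degree of a class *)

Section H1.
Variable m : nat.
Implicit Types (K : diagram m) (h e v : 'I_m) (c d u : {ffun 'I_m -> int}).

Lemma H1classP K (x y : cocycle K) :
  H1class x = H1class y <-> is_cob K (cocycle_val x - cocycle_val y).
Proof.
rewrite -[is_cob _ _]/(is_cob K (cocycle_val (x - y))) -coboundaryP.
rewrite (Quotient.idealrBE (@coboundary m K : zmodClosed _)).
by split=> /eqP.
Qed.

Lemma H1classMn K (x : cocycle K) k : H1class (x *+ k) = H1class x *+ k.
Proof.
have H1classD : {morph @H1class m K : a b / a + b}.
  by move=> a b; rewrite /H1class !piE.
elim: k => [|k IHk]; last by rewrite !mulrS H1classD IHk.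
rewrite !mulr0n; apply: (@addrI _ (H1class x)).
by rewrite -H1classD !addr0.
Qed.

Lemma H1_ind K (P : H1 K -> Prop) :
  (forall x : cocycle K, P (H1class x)) -> forall z, P z.
Proof. by move=> Px z; rewrite -[z]reprK; exact: Px. Qed.

Lemma cocycle_valMn K (x : cocycle K) k : cocycle_val (x *+ k) = cocycle_val x *+ k.
Proof. exact: (raddfMn (val : cocycle K -> _)). Qed.

Definition divides K k c : Prop := exists d, quotient_of K c k d.

Lemma H1_divides K (x : cocycle K) k :
  (exists z, H1class x = z *+ k) <-> divides K k (cocycle_val x).
Proof.
split=> [[z]|[d [dK dq]]].
  elim/H1_ind: z => y; rewrite -H1classMn => /H1classP; rewrite cocycle_valMn.
  by exists (cocycle_val y); split; first exact: valP.
exists (H1class (Cocycle dK)); rewrite -H1classMn; apply/H1classP.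
by rewrite cocycle_valMn.
Qed.

Lemma H1_torsion_free K (z : H1 K) k : (0 < k)%N -> z *+ k = 0 -> z = 0.
Proof.
move=> k0; elim/H1_ind: z => x.
have <- : H1class (0 : cocycle K) = 0 by rewrite -[0 in LHS](mulr0n 0) H1classMn.
rewrite -H1classMn => /H1classP xk; apply/H1classP.
by apply: (cob_torsion_free k0); rewrite mulrnBl -cocycle_valMn mul0rn.
Qed.

(** The greatest divisor for the divisibility order, whose top is 0. Coboundaries thus get degree 0
    without a separate case. *)
Definition degree K c p : Prop :=
  divides K p c /\ forall k, divides K k c -> (k %| p)%N.

Lemma H1_degree K (x : cocycle K) p :
  has_bead_degree (H1class x) p <-> degree K (cocycle_val x) p.
Proof.
rewrite (has_bead_degreeP (@H1_torsion_free K)) H1_divides; split=> -[xp xmax].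
  by split=> // k /H1_divides[z /xmax].
by split=> // k z xz; apply/xmax/H1_divides; exists z.
Qed.

Lemma degree_uniq K c p q : degree K c p -> degree K c q -> p = q.
Proof.
move=> [cp pmax] [cq qmax]; apply/eqP.
by rewrite eqn_dvd qmax // pmax.
Qed.

Lemma quotient_of1 K c : c \in cocycle_pred K -> quotient_of K c 1 c.
Proof. by move=> cK; split=> //; rewrite mulr1n subrr; exact: cob0. Qed.

Lemma divides0 K c : divides K 0 c <-> is_cob K c.
Proof.
split=> [[d [_]]|cc]; first by rewrite mulr0n subr0.
by exists 0; split; rewrite ?rpred0 // mulr0n subr0.
Qed.

(* A potential for c modulo k is determined up to a constant on each component,
   so integers obtained by summing c along paths work modulo all divisors k of c. *)
Lemma divides_unbounded K c : c \in cocycle_pred K ->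
  (forall N, exists2 k, (N < k)%N & divides K k c) -> is_cob K c.
Proof.
move=> cK unbounded.
pose potential (k : nat) (g : 'I_m -> int) := (forall h, g (rot K h) = g h) /\
  forall h, (k %| c h - (g (opp K h) - g h))%Z.
have dvd_pot k : divides K k c -> exists g, potential k g.
  move=> [d [_ [g [gP dg]]]]; exists g; split=> // h; rewrite -dg !ffunE ffunMnE.
  by rewrite opprB addrC subrK -mulr_natr natz dvdz_mull.
(* Adjacent means starting at the same vertex or reversed, so the components are those of the
   graph. *)
pose adj := [rel h h' | [|| h' == rot K h, h == rot K h' | h' == opp K h]].
have adj_sym : symmetric adj.
  move=> h h' /=; rewrite orbCA; congr [|| _, _ | _].
  by rewrite eq_sym (inv_eq (@oppK m K)) eq_sym.
have path_sum r h : connect adj r h -> exists t : int, forall k g,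
    potential k g -> (k %| t - (g h - g r))%Z.
  move=> /connectP[p]; elim/last_ind: p h => [|p h' IHp] h /=.
    by move=> _ -> ; exists 0 => k g _; rewrite subrr subr0.
  rewrite rcons_path last_rcons => /andP[/IHp/(_ erefl)[t tP] ph] ->.
  case/or3P: ph => /eqP hE.
  - by exists t => k g gP; rewrite hE gP.1; exact: tP.
  - by exists t => k g gP; rewrite -gP.1 -hE; exact: tP.
  exists (t + c (last r p)) => k g gP; rewrite hE.
  have := rpredD (tP _ _ gP) (gP.2 (last r p)).
  by congr (_ %| _)%Z; ring.
have /choice[t tP] h : exists t : int, forall k g, potential k g ->
    (k %| t - (g h - g (fingraph.root adj h)))%Z.
  apply: path_sum.
  by rewrite (sym_connect_sym adj_sym) connect_root.
have csym := sym_connect_sym adj_sym.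
have root_opp h : fingraph.root adj (opp K h) = fingraph.root adj h.
  by apply/esym/(fingraph.rootP csym)/connect1; rewrite /= eqxx !orbT.
have root_rot h : fingraph.root adj (rot K h) = fingraph.root adj h.
  by apply/esym/(fingraph.rootP csym)/connect1; rewrite /= eqxx.
(* [t] was chosen edge by edge; evaluating it at a representative makes [s] constant on stars. *)
have [rep repP rep_star] := star_rep K; pose s h := t (rep h).
exists s; split=> h; first by rewrite /s (rep_star h) // mem_star_rot mem_star_id.
have sP k g h' : potential k g -> (k %| s h' - (g h' - g (fingraph.root adj h')))%Z.
  move=> gP; have := tP (rep h') k g gP.
  by rewrite (rot_inv_star gP.1 (repP h')) (rot_inv_star root_rot (repP h')).
(* The defect of [s] at [h] is divisible by some [k] larger than its absolute value, so it is 0. *)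
have [k ltk /dvd_pot[g gP]] := unbounded `|(c h - (s (opp K h) - s h))%R|%N.
have kdvd : (k %| c h - (s (opp K h) - s h))%Z.
  have := rpredB (rpredD (gP.2 h) (sP _ _ h gP)) (sP _ _ (opp K h) gP).
  by rewrite root_opp; congr (_ %| _)%Z; ring.
apply/eqP; rewrite -subr_eq0 -absz_eq0; apply: contraLR ltk.
by rewrite -lt0n -leqNgt => /dvdn_leq; apply.
Qed.

(** The divisors of a nonzero class include 1 and are bounded; the degree is the largest. *)
Lemma degree_exists K c : c \in cocycle_pred K -> exists p, degree K c p.
Proof.
move=> cK; have [cc|ncc] := pselect (is_cob K c).
  by exists 0%N; split; first exact/divides0.
have [N Nmax] : exists N, forall k, divides K k c -> (k <= N)%N.
  apply: contrapT => /forallNP nN; apply/ncc/divides_unbounded => // N.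
  have /existsNP[k /not_implyP[ck /negP]] := nN N.
  by rewrite -ltnNge; exists k.
have c1 : exists k, `[< divides K k c >].
  by exists 1%N; apply/asboolP; exists c; exact: quotient_of1.
have cN k : `[< divides K k c >] -> (k <= N)%N by move=> /asboolP; exact: Nmax.
case: (ex_maxnP c1 cN) => p /asboolP cp pmax; exists p.
have /H1_divides[y xy] : divides K p (cocycle_val (Cocycle cK)) by [].
rewrite -[c]/(cocycle_val (Cocycle cK)) -H1_degree.
apply: (has_bead_degree_max _ xy) => [x0|k z xz]; last first.
  by apply/pmax/asboolP; apply/(H1_divides (Cocycle cK)); exists z.
apply/ncc/divides0; rewrite -[c]/(cocycle_val (Cocycle cK)) -H1_divides.
by exists 0; rewrite x0.
Qed.

End H1.

Lemma divides_iso m (K K' : diagram m) s (c c' : {ffun 'I_m -> int}) k :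
  diagram_iso K K' s -> (forall h, c' (s h) = c h) ->
  divides K k c <-> divides K' k c'.
Proof.
move=> sP sc; split=> -[d dq].
  by exists [ffun h => d (s^-1 h)%g]; exact: quotient_of_iso sP sc dq.
exists [ffun h => d ((s^-1)^-1 h)%g]; apply: quotient_of_iso (diagram_isoV sP) _ dq => h.
by rewrite -sc permKV.
Qed.

Lemma eq_degree m (K K' : diagram m) (c c' : {ffun 'I_m -> int}) :
  (forall k, divides K k c <-> divides K' k c') ->
  forall p, degree K c p <-> degree K' c' p.
Proof.
move=> e p; split=> -[cp pmax]; split; try exact/e.
  by move=> k /e/pmax.
by move=> k /e/pmax.
Qed.

(** The triple is cyclically symmetric, so passing from one graph to the other two is enough for the
    equivalences. *)
Lemma ihx_divides m (K12 K23 K31 : diagram m) e (c : {ffun 'I_m -> int}) k :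
  ihx_triple K12 K23 K31 e -> c \in cocycle_pred K12 -> c e = 0 ->
  (divides K12 k c <-> divides K23 k c) /\ (divides K12 k c <-> divides K31 k c).
Proof.
move=> T12 cK c0; have T23 := ihx_triple_rot T12; have T31 := ihx_triple_rot T23.
have [e1 [e2 _]] := T12.
have cK2 : c \in cocycle_pred K23 by rewrite (cocycle_pred_opp _ e1).
have cK3 : c \in cocycle_pred K31 by rewrite (cocycle_pred_opp _ e2).
have to_all (L12 L23 L31 : diagram m) : ihx_triple L12 L23 L31 e ->
    c \in cocycle_pred L12 -> divides L12 k c -> divides L23 k c /\ divides L31 k c.
  move=> T cL [d dq]; have [d' _ [_ ? ?]] := quotient_of_ihx T cL c0 dq.
  by split; exists d'.
by split; split=> [/(to_all _ _ _ T12 cK)|]; [case|move/(to_all _ _ _ T23 cK2)|case|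
  move/(to_all _ _ _ T31 cK3)]; try by case.
Qed.

(** * Truncation, multiplication and division of invariant functions *)

Section InvariantOperations.
Variables (V : lmodType rat) (phi : forall m, diagram m -> {ffun 'I_m -> int} -> V).
Hypothesis phiP : bead_invariant phi.

Definition restrict_degree p m (K : diagram m) c : V :=
  if `[< degree K c p >] then phi K c else 0.

Lemma restrict_degree_invariant p : bead_invariant (restrict_degree p).
Proof.
have [iso AS IHX PUSH] := phiP.
split=> [m K K' s c c' sP cK sc|m K K' h c rP cK|m K12 K23 K31 e c rP cK c0|
         m K v c cK]; rewrite /restrict_degree.
- rewrite -(iso _ _ _ _ _ _ sP cK sc); congr (if _ then _ else _).
  by apply: asbool_equiv_eq; apply: eq_degree => k; exact: divides_iso sP sc.
- have <- : `[< degree K c p >] = `[< degree K' c p >].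
    apply: asbool_equiv_eq; apply: eq_degree => k.
    by split=> -[d dq]; exists d; apply/(quotient_of_reversed _ _ _ rP).
  by case: asboolP => _; rewrite ?addr0 ?(AS _ _ _ _ _ rP cK).
- have <- : `[< degree K12 c p >] = `[< degree K23 c p >].
    by apply: asbool_equiv_eq; apply: eq_degree => k; exact: (ihx_divides k rP cK c0).1.
  have <- : `[< degree K12 c p >] = `[< degree K31 c p >].
    by apply: asbool_equiv_eq; apply: eq_degree => k; exact: (ihx_divides k rP cK c0).2.
  by case: asboolP => _; rewrite ?addr0 ?(IHX _ _ _ _ _ _ rP cK).
rewrite PUSH //; congr (if _ then _ else _).
apply: asbool_equiv_eq; apply: eq_degree => k.
by split=> -[d dq]; exists d; apply/(quotient_of_cob _ _ _ (cob_vertex K v)).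
Qed.

Definition multiply p m (K : diagram m) (c : {ffun 'I_m -> int}) : V :=
  phi K (c *+ p).

Lemma multiply_invariant p : bead_invariant (multiply p).
Proof.
have [iso AS IHX _] := phiP.
split=> [m K K' s c c' sP cK sc|m K K' h c rP cK|m K12 K23 K31 e c rP cK c0|
         m K v c cK]; rewrite /multiply.
- by apply: iso sP _ _ => [|h]; rewrite ?rpredMn // !ffunMnE sc.
- by apply: AS rP _; rewrite rpredMn.
- by apply: IHX rP _ _; rewrite ?rpredMn // ffunMnE c0 mul0rn.
rewrite mulrnDl; apply: invariant_cob; rewrite ?rpredMn //.
exact/cobMn/cob_vertex.
Qed.

(** For [p > 0] the value is independent of the chosen quotient. Extension by 0 respects the
    relations because divisibility by [p] does. *)
Definition divide p m (K : diagram m) c : V :=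
  if pselect (divides K p c) is left ex then phi K (sval (cid ex)) else 0.

Lemma divideE p m (K : diagram m) c d : (0 < p)%N ->
  quotient_of K c p d -> divide p K c = phi K d.
Proof.
move=> p0 dq; rewrite /divide; case: pselect => [ex|[]]; last by exists d.
by case: cid => d' /= d'q; exact: quotient_of_uniq p0 d'q dq.
Qed.

Lemma divide0 p m (K : diagram m) c : ~ divides K p c -> divide p K c = 0.
Proof. by rewrite /divide; case: pselect. Qed.

Lemma divide_invariant p : (0 < p)%N -> bead_invariant (divide p).
Proof.
move=> p0; have [iso AS IHX _] := phiP.
split=> [m K K' s c c' sP cK sc|m K K' h c rP cK|m K12 K23 K31 e c rP cK c0|
         m K v c cK].
- have [[d dq]|nd] := pselect (divides K p c); last first.
    by rewrite !divide0 -?(divides_iso _ sP sc).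
  rewrite (divideE p0 dq) (divideE p0 (quotient_of_iso sP sc dq)).
  by apply: iso sP dq.1 _ => h; rewrite ffunE permK.
- have [[d dq]|nd] := pselect (divides K p c).
    rewrite (divideE p0 dq) (divideE p0 (_ : quotient_of K' c p d)).
      exact: AS rP dq.1.
    exact/(quotient_of_reversed _ _ _ rP).
  rewrite !divide0 ?addr0 // => -[d dq]; apply: nd; exists d.
  exact/(quotient_of_reversed _ _ _ rP).
- have [[d dq]|nd] := pselect (divides K12 p c).
    (* IHX for [phi] needs a quotient vanishing on [e]. [d'] is one, valid in all three graphs. *)
    have [d' d'0 [q12 q23 q31]] := quotient_of_ihx rP cK c0 dq.
    rewrite (divideE p0 q12) (divideE p0 q23) (divideE p0 q31).
    exact: IHX rP q12.1 d'0.
  have [d23 d31] := ihx_divides p rP cK c0.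
  by rewrite !divide0 ?addr0 -?d23 -?d31.
have cobP := quotient_of_cob _ _ _ (cob_vertex K v).
have [[d dq]|nd] := pselect (divides K p c).
  by rewrite (divideE p0 dq); apply/(divideE p0)/cobP.
by rewrite !divide0 // => -[d /cobP dq]; apply: nd; exists d.
Qed.

End InvariantOperations.

(** * The isomorphisms and the grading *)

Definition forget m (K : diagram m) (c : {ffun 'I_m -> int}) : spaceA :=
  lproj relA (dgen K).

Lemma forget_invariant : bead_invariant forget.
Proof.
split=> [m K K' s c c' sP cK sc|m K K' h c rP cK|m K12 K23 K31 e c rP cK c0|//].
- exact: lproj_sub (relA_iso sP).
- exact: lproj_add (relA_AS rP).
- exact: lproj_add3 (relA_IHX rP).
Qed.

Lemma cls_lift (V : lmodType rat) phi : bead_invariant phi ->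
  exists F : {linear spaceAR -> V}, forall m (K : diagram m) c,
    c \in cocycle_pred K -> F (cls K c) = phi m K c.
Proof.
move=> /spaceAR_lift[F FE]; exists F => m K c cK.
by rewrite clsE FE.
Qed.

Lemma genARP n p v : genARp n p v <-> exists m (K : diagram m) c,
  [/\ loop_degree K = n, c \in cocycle_pred K, degree K c p & v = cls K c].
Proof.
split=> [[m K c Kn /H1_degree cp]|[m [K [c [Kn cK cp ->]]]]].
  by exists m, K, (cocycle_val c); rewrite cls_val; split=> //; exact: valP.
by rewrite clsE; apply: GenARp => //; apply/H1_degree.
Qed.

Lemma cls_cob m (K : diagram m) u c : is_cob K u -> c \in cocycle_pred K ->
  cls K (u + c) = cls K c.
Proof. exact: invariant_cob cls_invariant. Qed.

Lemma degree0 m (K : diagram m) c : degree K c 0 -> is_cob K c.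
Proof. by move=> [/divides0]. Qed.

Lemma degree_cob m (K : diagram m) : degree K 0 0.
Proof. by split=> // ; apply/divides0; exact: cob0. Qed.

Lemma AR0_isomorphic n : isomorphic (AR n 0) (A n).
Proof.
have [eps epsE] := cls_lift forget_invariant.
have [iota iotaE] : exists iota : {linear spaceA -> spaceAR},
    forall m (K : diagram m), iota (lproj relA (dgen K)) = cls K 0.
  have [iso AS IHX _] := cls_invariant.
  apply: (@spaceA_lift _ (fun K => cls (tagged K) 0)) => [m K K' s sP|m K K' h rP|
      m K12 K23 K31 e rP] /=.
  - by apply: iso sP _ _ => [|h]; rewrite ?rpred0 // !ffunE.
  - by apply: AS rP _; rewrite rpred0.
  - by apply: IHX rP _ _; rewrite ?rpred0 // ffunE.
apply: (@isomorphic_subspace _ _ _ _ eps iota).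
- move=> _ /genARP[m [K [c [Kn cK _ ->]]]]; rewrite epsE //.
  by apply: lspan_gen; exact: GenA.
- move=> _ [m K Kn]; rewrite iotaE; apply/lspan_gen/genARP; exists m, K, 0.
  by split; rewrite ?rpred0 //; exact: degree_cob.
- move=> _ /genARP[m [K [c [Kn cK /degree0 c0 ->]]]]; rewrite epsE // iotaE.
  by rewrite -[c]addr0 cls_cob ?rpred0.
by move=> _ [m K Kn]; rewrite iotaE epsE // rpred0.
Qed.

Lemma quotient_of_mulrn m (K : diagram m) (c : {ffun 'I_m -> int}) p :
  c \in cocycle_pred K -> quotient_of K (c *+ p) p c.
Proof. by move=> cK; split; rewrite // subrr; exact: cob0. Qed.

Lemma degree_mulrn m (K : diagram m) (c : {ffun 'I_m -> int}) p : (0 < p)%N ->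
  c \in cocycle_pred K -> degree K c 1 -> degree K (c *+ p) p.
Proof.
move=> p0 cK; rewrite -[c]/(cocycle_val (Cocycle cK)) => /H1_degree[y yI cy].
rewrite -cocycle_valMn; apply/H1_degree; rewrite H1classMn cy mulr1n.
by case: p p0 => // p _; exists y.
Qed.

(** A divisor k of [d] yields the divisor k p of [c], which must divide p; hence k = 1. *)
Lemma degree_quotient m (K : diagram m) (c d : {ffun 'I_m -> int}) p : (0 < p)%N ->
  degree K c p -> quotient_of K c p d -> degree K d 1.
Proof.
move=> p0 [cp pmax] [dK dq]; split; first by exists d; exact: quotient_of1.
move=> k [d' [d'K d'q]]; have : (k * p %| p)%N.
  apply: pmax; exists d'; split=> //.
  have -> : c - d' *+ (k * p) = (c - d *+ p) + (d - d' *+ k) *+ p.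
    by rewrite mulrnBl -mulrnA addrA subrK.
  exact/cobD/cobMn.
by rewrite -[X in (_ %| X)%N]mul1n dvdn_pmul2r.
Qed.

Lemma AR_isomorphic n p : (0 < p)%N -> isomorphic (AR n p) (AR n 1).
Proof.
move=> p0; have [mu muE] := cls_lift (multiply_invariant cls_invariant p).
have [theta thetaE] := cls_lift (divide_invariant cls_invariant p0).
have divE := divideE cls_invariant p0.
apply: (@isomorphic_subspace _ _ _ _ theta mu).
- move=> _ /genARP[m [K [c [Kn cK cp ->]]]]; have [[d dq] _] := cp.
  rewrite thetaE // (divE _ _ _ _ dq); apply/lspan_gen/genARP; exists m, K, d.
  by split=> //; [exact: dq.1 | exact: degree_quotient cp dq].
- move=> _ /genARP[m [K [c [Kn cK c1 ->]]]]; rewrite muE //.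
  apply/lspan_gen/genARP; exists m, K, (c *+ p).
  by split; rewrite ?rpredMn //; exact: degree_mulrn.
- move=> _ /genARP[m [K [c [Kn cK [[d dq] _] ->]]]].
  rewrite thetaE // (divE _ _ _ _ dq) muE ?dq.1 // /multiply.
  by rewrite -[c in RHS](subrK (d *+ p)) cls_cob ?rpredMn ?dq.1 //; exact: dq.2.
move=> _ /genARP[m [K [c [Kn cK c1 ->]]]]; rewrite muE // /multiply.
rewrite thetaE ?rpredMn //; apply: divE; exact: quotient_of_mulrn.
Qed.

(** Expanding the beads does not change the graph, so spanning by cocycles holds in each loop
    degree. *)
Lemma genAR_cocycle_gen n v : v \in lspan (genAR n) ->
  v \in lspan (fun w => exists m (K : diagram m) c,
    [/\ loop_degree K = n, c \in cocycle_pred K & w = cls K c]).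
Proof.
apply: lspan_sub => _ [m X Xn]; have := bgen_spanned X.
apply: lspan_sub => _ [x ->]; apply: lspan_gen.
by exists m, (graph X), (cocycle_val x); rewrite cls_val; split=> //; exact: valP.
Qed.

(** Applying [pr q] to a finite decomposition isolates its component in [W q], whence uniqueness.
    For existence, the components [pr p v] vanish from [N] on. *)
Lemma finite_support_direct_sum (V : lmodType rat) (U : {pred V})
    (W : nat -> submodClosed V) (pr : nat -> {linear V -> V}) :
  (forall p, {subset W p <= U}) ->
  (forall p q, {in W q, forall v, pr p v = if p == q then v else 0}) ->
  (forall p, {in U, forall v, pr p v \in W p}) ->
  {in U, forall v, exists N, v = \sum_(p < N) pr p v} ->
  direct_sum U W.
Proof.
move=> WU prW prU fin; split=> // v Uv; have [N vN] := fin v Uv.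
have pr0 q : (N <= q)%N -> pr q v = 0.
  move=> leNq; rewrite vN linear_sum big1 // => p _.
  rewrite (prW _ p) ?prU //; case: eqP => // qp.
  by move: leNq; rewrite qp leqNgt ltn_ord.
pose S := [fset p in iota 0 N]%fset.
pose w := [fsfun p in S => pr p v | 0] : {fsfun nat -> V with 0}.
have wE p : w p = pr p v.
  rewrite fsfunE !inE mem_iota add0n; case: ltnP => // /pr0 -> //.
exists w; split=> [|w' [w'W vw']].
  split=> [p|]; first by rewrite wE prU.
  have le_wS : (finsupp w `<=` S)%fset.
    by apply/fsubsetP => p; apply: contraLR => pS; rewrite memNfinsupp fsfunE (negPf pS).
  rewrite (big_fset_incl _ le_wS) /=; last by move=> p _; rewrite memNfinsupp => /eqP.
  rewrite [LHS]vN -(big_mkord xpredT (fun p => pr p v)) /index_iota subn0.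
  rewrite (eq_bigr _ (fun p _ => wE p)); apply: perm_big.
  apply: uniq_perm; rewrite ?iota_uniq ?fset_uniq // => p.
  by rewrite inE.
apply/fsfunP => q; rewrite wE vw' linear_sum.
rewrite (eq_bigr (fun p => if q == p then w' p else 0)) => [|p _]; last exact: prW.
have [qw'|] := boolP (q \in finsupp w'); last first.
  move=> qw'; have := qw'; rewrite memNfinsupp => /eqP ->.
  rewrite big_seq big1 // => p pw'.
  by case: eqP => // qp; move: qw'; rewrite qp pw'.
rewrite (big_fsetD1 q) //= eqxx big_seq big1 ?addr0 // => p.
by rewrite !inE eq_sym => /andP[/negPf ->].
Qed.

Theorem theorem3 (n : nat) :
  [/\ (forall (p q : nat) (v : spaceAR), v != 0%R ->
         v \in lspan (genARp n p) -> v \in lspan (genARp n q) -> p = q),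
      direct_sum (lspan (genAR n)) (fun p => lspan (genARp n p)),
      isomorphic (AR n 0) (A n)
    & forall p : nat, (0 < p)%N -> isomorphic (AR n p) (AR n 1)].
Proof.
have /choice[pr prE] p :
    exists F : {linear spaceAR -> spaceAR}, forall m (K : diagram m) c,
      c \in cocycle_pred K -> F (cls K c) = restrict_degree cls p K c.
  exact: cls_lift (restrict_degree_invariant cls_invariant p).
have prW p q : {in lspan (genARp n q), forall v, pr p v = if p == q then v else 0}.
  have prq v : genARp n q v -> pr p v = if p == q then v else 0.
    move=> /genARP[m [K [c [_ cK cq ->]]]]; rewrite prE // /restrict_degree.
    have [->|/eqP pq] := eqVneq p q; first by case: asboolP.
    by case: asboolP => // cp; case: pq; exact: degree_uniq cp cq.
  case: eqP prq => _ prq; first exact: (eq_on_lspan (g := idfun)).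
  exact: (eq_on_lspan (g := \0)).
split; first 1 last.
- apply: (@finite_support_direct_sum _ _ (fun p => lspan (genARp n p)) pr) => //.
  + move=> p; apply: lspan_sub => _ [m K c Kn _]; apply: lspan_gen.
    exact: (@GenAR n m (cocycle_beaded c)).
  + move=> p v /genAR_cocycle_gen; apply: lspan_map => _ [m [K [c [Kn cK ->]]]].
    rewrite prE // /restrict_degree; case: asboolP => cp; last exact: rpred0.
    by apply/lspan_gen/genARP; exists m, K, c.
  move=> v /genAR_cocycle_gen vn.
  (* Asking for all [M] beyond [N] lets a linear combination use a common bound. *)
  suff [N vN] : exists N, forall M, (N <= M)%N -> v = \sum_(p < M) pr p v.
    by exists N; exact: vN.
  move: v vn; apply: lspan_ind => [|a u v [M uM] [N vN]|_ [m [K [c [_ cK ->]]]]].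
  + by exists 0%N => M _; rewrite big1 // => p _; rewrite linear0.
  + exists (maxn M N) => L; rewrite geq_max => /andP[ML NL].
    rewrite {1}(uM L ML) {1}(vN L NL) scaler_sumr -big_split.
    by apply: eq_bigr => p _; rewrite linearP.
  have [p cp] := degree_exists cK; exists p.+1 => M ltpM.
  rewrite (bigD1 (Ordinal ltpM)) //= prE // /restrict_degree asboolT //.
  rewrite big1 ?addr0 // => q; apply: contraNeq => prq; apply/eqP/val_inj => /=.
  move: prq; rewrite prE // /restrict_degree; case: asboolP => [cq _|].
    exact: degree_uniq cq cp.
  by rewrite eqxx.
- exact: AR0_isomorphic.
- exact: AR_isomorphic.
move=> p q v v0 vp vq; apply/eqP; apply: contraNT v0 => /negPf pq.
(* The projection to degree [p] fixes [v] as an element of degree [p] and kills it as one of degree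
   [q]. *)
by have := prW p p v vp; rewrite (prW p q v vq) pq eqxx => <-.
Qed.
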